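(* Consider a parametric family of linear programs $(\mathcal{K}_t,c_t)_{t>1}$ in $\mathbb{R}^n$ (the sets $\mathcal{K}_t$ are polyhedra) with $\vartheta$-self-concordant barriers $(f_t)_{t>1}$, as described in the context, with central paths $\mathcal{C}_t$ and tropical central path $\mathsf{C}$. Let $0<\underline m<1<\bar m$ and let $\lambda^* := -\sup_{x\in\mathsf{K}}\langle\mathsf{c},x\rangle_{\mathbb{T}}$. Consider a sequence of segments $[x^0,x^1]\cup[x^1,x^2]\cup\dots\cup[x^{p-1},x^p]$ contained in the neighborhood $\mathcal{M}_{\underline m,\bar m,t}([t^{\lambda^*},+\infty[)$ of $\mathcal{C}_t$, and such that $\underline v := \langle c_t,x^0\rangle \geq \langle c_t,x^p\rangle =: \bar v$. Provided that $t$ is large enough, this sequence contains at least $\gamma([-\log_t\underline v,-\log_t\bar v])$ segments, i.e. $p\geq\gamma([-\log_t\underline v,-\log_t\bar v])$.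
   Context: Notation: $\mathbb{T} := \mathbb{R}\cup\{-\infty\}$ (with the order topology; $\mathbb{T}^n$ with the product topology), $\vee$ is the (entrywise) maximum, $\log_t(\cdot) := \log(\cdot)/\log t$ applied entrywise, with $\log_t 0 := -\infty$; $e$ is the all-ones vector; inequalities between vectors are entrywise. For $u,v \in \mathbb{T}^n$, $d_\infty(u,v) := \inf\{\lambda \geq 0 : u-\lambda e \leq v \leq u+\lambda e\}$, and for closed sets $d_\infty(U,V)$ is the induced Hausdorff distance. For $x,y \in \mathbb{T}^n$, $\langle x,y\rangle_{\mathbb{T}} := \max_i(x_i+y_i)$. Self-concordant barriers: let $f$ be a $C^2$ real-valued function on an open convex set $D_f \subset \mathbb{R}^n$, with gradient $g(x)$ and positive definite Hessian $H(x)$. Put $\|v\|_x := \sqrt{v^\top H(x) v}$ and $B_x(y,r) := \{z : \|y-z\|_x < r\}$. The function $f$ is (strongly nondegenerate) self-concordant if for all $x \in D_f$ we have $B_x(x,1) \subset D_f$ and, for all $y \in B_x(x,1)$ and $v \neq 0$, $1-\|y-x\|_x \leq \|v\|_y/\|v\|_x \leq 1/(1-\|y-x\|_x)$. It is a $\vartheta$-self-concordant barrier over $D_f$ if moreover $\sup_{x \in D_f} \|H(x)^{-1}g(x)\|_x^2 \leq \vartheta$. Setting: for every $t>1$, $\mathcal{K}_t \subset \mathbb{R}^n_{\geq 0}$ is a polyhedron with nonempty interior and $0 \in \mathcal{K}_t$, $c_t \in \mathbb{R}^n_{\geq 0}$, and $f_t$ is a $\vartheta$-self-concordant barrier over $\operatorname{int}\mathcal{K}_t$,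 with $\vartheta$ independent of $t$. For $\eta>0$, $\mathcal{C}_t(\eta)$ is the unique minimizer (assumed to exist) of $\eta\langle c_t,x\rangle + f_t(x)$ over $\operatorname{int}\mathcal{K}_t$. Assumptions: there exist $\mathsf{K} \subset \mathbb{T}^n$ and $\mathsf{c} \in \mathbb{T}^n$ such that (i) $d_\infty(\log_t \mathcal{K}_t, \mathsf{K}) = O(1/\log t)$ and $d_\infty(\log_t c_t,\mathsf{c}) = O(1/\log t)$; (ii) $\mathsf{K}$ is equal to the closure of its interior; (iii) $\mathsf{K}\cap\mathbb{R}^n$ is a finite union of polyhedra. The quantity $\max\big(d_\infty(\log_t\mathcal{K}_t,\mathsf{K}), d_\infty(\log_t c_t,\mathsf{c})\big)\log t$ is bounded over $t>1$. Tropical central path: $\mathsf{C}(\lambda)$ ($\lambda\in\mathbb{R}$) is the entrywise supremum of $\{x \in \mathsf{K} : \langle \mathsf{c},x\rangle_{\mathbb{T}} \leq -\lambda\}$ (these sets are assumed to be bounded from above). Multiplicative neighborhoods: $\mathcal{M}_{\underline m,\bar m,t}(\eta) := \{x\in\mathcal{K}_t : \underline m\,\mathcal{C}_t(\eta)\leq x\leq\bar m\,\mathcal{C}_t(\eta)\}$, and for an interval $J$, $\mathcal{M}_{\underline m,\bar m,t}(J) := \bigcup_{\eta\in J,\ \eta>0}\mathcal{M}_{\underline m,\bar m,t}(\eta)$; by convention $t^{-\infty}=0$. Complexity of the tropical central path: for $u,v\in\mathbb{T}^n$, the tropical segment is $\operatorname{tsegm}(u,v) := \{(u+\lambda e)\vee(v+\mu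 e) : \lambda,\mu\in\mathbb{T},\ \lambda\vee\mu = 0\}$. In the linear programming setting considered, $\mathsf{C}$ is a concatenation of finitely many tropical segments (known fact). $\gamma([a,b])$ is the minimal number of tropical segments needed to describe $\mathsf{C}([a,b])$, i.e. the smallest $p$ such that there exist $a=\lambda_0\leq\dots\leq\lambda_p=b$ with $\mathsf{C}([\lambda_{i-1},\lambda_i]) = \operatorname{tsegm}(\mathsf{C}(\lambda_{i-1}),\mathsf{C}(\lambda_i))$ for all $i$.
   Formalization: ''Provided that t is large enough'' is read with the exponents −log_t v̲ and −log_t v̄ fixed first: the threshold on t may depend on these two numbers (but not on p or the segments), since a threshold uniform over all sequences makes the claim false. *)

(* Defs.v *)
From HB Require Import structures.
From mathcomp Require Import all_boot all_order all_algebra.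
From mathcomp Require Import all_classical all_reals all_analysis.

Set Implicit Arguments.
Unset Strict Implicit.
Unset Printing Implicit Defensive.

Import Order.TTheory GRing.Theory Num.Theory.
Import numFieldNormedType.Exports.

Local Open Scope classical_set_scope.
Local Open Scope ring_scope.

Section real_part.
Context {R : realType} {n : nat}.
Implicit Types (x y v c : 'cV[R]_n) (f : 'cV[R]_n -> R) (D : set 'cV[R]_n).

Definition dot c x : R := \sum_(i < n) c i ord0 * x i ord0.

Definition segment x y : set 'cV[R]_n :=
  [set (1 - s) *: x + s *: y | s in `[0, 1]].

Definition polyhedron (P : set 'cV[R]_n) : Prop :=
  exists (m : nat) (A : 'M[R]_(m, n)) (b : 'cV[R]_m),
    P = [set x | forall i, (A *m x) i ord0 <= b i ord0].

Definition basis_vec (i : 'I_n) : 'cV[R]_n := delta_mx i ord0.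

Definition partial f (i : 'I_n) : 'cV[R]_n -> R :=
  fun x => 'D_(basis_vec i) f x.

Definition grad f x : 'cV[R]_n := \col_i partial f i x.

Definition hess f x : 'M[R]_n := \matrix_(i, j) partial (partial f j) i x.

(* Meaningful for open D, where the values of f outside D are irrelevant. *)
Definition C2_on D f : Prop :=
  forall x, D x -> forall i j : 'I_n,
    [/\ derivable f x (basis_vec j),
        {for x, continuous (partial f j)},
        derivable (partial f j) x (basis_vec i) &
        {for x, continuous (partial (partial f j) i)}].

Definition pos_def (H : 'M[R]_n) : Prop :=
  forall v, v != 0 -> 0 < (v^T *m H *m v) ord0 ord0.

Definition local_norm f x v : R :=
  Num.sqrt ((v^T *m hess f x *m v) ord0 ord0).

Definition local_ball f x y (r : R) : set 'cV[R]_n :=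
  [set z | local_norm f x (y - z) < r].

Definition self_concordant D f : Prop :=
  [/\ open D,
      convex_set D,
      C2_on D f,
      (forall x, D x -> pos_def (hess f x)) &
      forall x, D x ->
        local_ball f x x 1 `<=` D /\
        forall y v, local_ball f x x 1 y -> v != 0 ->
          1 - local_norm f x (y - x) <= local_norm f y v / local_norm f x v
            <= 1 / (1 - local_norm f x (y - x))].

Definition self_concordant_barrier D f (vartheta : R) : Prop :=
  self_concordant D f /\
  forall x, D x ->
    local_norm f x (invmx (hess f x) *m grad f x) ^+ 2 <= vartheta.

Definition unique_minimizer D f x : Prop :=
  D x /\ forall y, D y -> f x <= f y /\ (f y = f x -> y = x).

Definition mult_nbhd (K : set 'cV[R]_n) (C : R -> 'cV[R]_n) (m1 m2 eta : R) :
    set 'cV[R]_n :=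
  [set x | K x /\
    forall i, m1 * C eta i ord0 <= x i ord0 <= m2 * C eta i ord0].

Definition mult_nbhd_on (K : set 'cV[R]_n) (C : R -> 'cV[R]_n) (m1 m2 : R)
    (J : set R) : set 'cV[R]_n :=
  \bigcup_(eta in J `&` [set eta | 0 < eta]) mult_nbhd K C m1 m2 eta.

End real_part.

(* The max-plus semiring is [-oo, +oo[ inside \bar R, and tropical vectors are  *)
(* column matrices over \bar R satisfying tvec; the topology of matrices is the *)
(* product topology.                                                            *)
Section tropical_part.
Context {R : realType} {n : nat}.
Implicit Types (u v c : 'cV[\bar R]_n) (K U V : set 'cV[\bar R]_n).
Local Open Scope ereal_scope.

Definition tvec : set 'cV[\bar R]_n := [set u | forall i, u i ord0 < +oo].

Definition tdot c u : \bar R := \big[maxe/-oo]_(i < n) (c i ord0 + u i ord0).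

(* lne maps 0 to -oo *)
Definition logt (t x : R) : \bar R := lne x%:E * ((ln t)^-1)%:E.

Definition logtv (t : R) (x : 'cV[R]_n) : 'cV[\bar R]_n :=
  \col_i logt t (x i ord0).

Definition epow (t : R) (l : \bar R) : \bar R :=
  match l with
  | r%:E => (t `^ r)%:E
  | +oo => +oo
  | -oo => 0
  end.

Definition dinf u v : \bar R :=
  ereal_inf [set l%:E | l in [set l : R | (0 <= l)%R /\
    forall i, u i ord0 - l%:E <= v i ord0 <= u i ord0 + l%:E]].

Definition dinf_set u V : \bar R := ereal_inf [set dinf u v | v in V].

Definition hausdorff U V : \bar R :=
  maxe (ereal_sup [set dinf_set u V | u in U])
       (ereal_sup [set dinf_set v U | v in V]).

(* tvec is open in 'cV[\bar R]_n, so for K included in tvec the interior is the *)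
(* same in both spaces; the closure has to be restricted to tvec.               *)
Definition regular_closed K : Prop := K = closure K° `&` tvec.

Definition finite_points K : set 'cV[R]_n := [set x | K (map_mx EFin x)].

Definition finite_union_of_polyhedra (P : set 'cV[R]_n) : Prop :=
  exists (N : nat) (Q : 'I_N -> set 'cV[R]_n),
    (forall k, polyhedron (Q k)) /\ P = \bigcup_k Q k.

Definition tsublevel K c (lambda : R) : set 'cV[\bar R]_n :=
  [set u | K u /\ tdot c u <= - lambda%:E].

Definition bounded_from_above U : Prop :=
  exists M : R, forall u, U u -> forall i, u i ord0 <= M%:E.

Definition tcentral_path K c (lambda : R) : 'cV[\bar R]_n :=
  \col_i ereal_sup [set u i ord0 | u in tsublevel K c lambda].

Definition tsegm u v : set 'cV[\bar R]_n :=
  [set w | exists l m : \bar R, maxe l m = 0 /\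
    w = \col_i maxe (u i ord0 + l) (v i ord0 + m)].

(* The path C restricted to [a, b] is a concatenation of p tropical segments;   *)
(* only l 0, ..., l p matter.                                                   *)
Definition tsegm_decomposition (C : R -> 'cV[\bar R]_n) (a b : R) (p : nat) :
    Prop :=
  exists l : nat -> R,
    [/\ l 0%N = a, l p = b &
        forall i, (i < p)%N -> (l i <= l i.+1)%R /\
          C @` `[l i, l i.+1] = tsegm (C (l i)) (C (l i.+1))].

(* +oo if there is no decomposition *)
Definition tcomplexity (C : R -> 'cV[\bar R]_n) (a b : R) : \bar R :=
  ereal_inf [set (p%:R)%:E | p in tsegm_decomposition C a b].

End tropical_part.

(* Main.v *)
(* Write x = C_t(eta), so that the gradient of f_t at x is - eta c_t. The barrier
   inequalities <g(x), y - x> <= theta (y in the interior of K_t) and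
   ||y - x||_x = O(theta) (when moreover <g(x), y - x> >= -1) give
   <c_t, x> = O(1 / eta), and y = O(x) for every y in K_t such that
   <c_t, y> <= 1 / eta. Read through log_t, this says that log_t C_t(t^lambda) is
   within O(1 / log t) of C(lambda), uniformly in lambda.

   If z is in the neighborhood, at some eta >= t^lambda_star, then <c_t, z> is of order
   1 / eta, so log_t z is within O(1 / log t) of C(- log_t <c_t, z>). Since the cost is
   affine along a segment, a segment descending from the level mu to the level nu yields
     C(lambda) <= (C(mu) - (lambda - mu)) v C(nu) + O(1 / log t),  mu <= lambda <= nu,
   where v is the entrywise maximum. The reverse inequality is exact because C is
   nonincreasing and C(lambda) + lambda is nondecreasing; without error term, the two
   together say that C([mu, nu]) is the tropical segment between C(mu) and C(nu). For
   a fixed number p of segments the levels of the breakpoints range over a compact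
   set, so below some error threshold an approximate decomposition of C([a, b]) into p
   pieces yields an exact one; only the finitely many p below the complexity of
   C([a, b]) matter. *)

Require Import Defs.
From HB Require Import structures.
From mathcomp Require Import all_boot all_order all_algebra.
From mathcomp Require Import all_classical all_reals all_analysis.
From mathcomp Require Import ring lra.

Import Order.TTheory GRing.Theory Num.Theory.
Import numFieldNormedType.Exports.

Local Open Scope classical_set_scope.
Local Open Scope ring_scope.

Set Implicit Arguments.
Unset Strict Implicit.
Unset Printing Implicit Defensive.

(** * Self-concordant barriers *)

Section dot_product.
Context {R : realType} {n : nat}.
Implicit Types (c x y : 'cV[R]_n).

Lemma dotD c x y : dot c (x + y) = dot c x + dot c y.
Proof. by rewrite -big_split; apply: eq_bigr => i _; rewrite mxE mulrDr. Qed.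

Lemma dotZ c a x : dot c (a *: x) = a * dot c x.
Proof. by rewrite mulr_sumr; apply: eq_bigr => i _; rewrite mxE mulrCA. Qed.

Lemma dotB c x y : dot c (x - y) = dot c x - dot c y.
Proof. by rewrite dotD -scaleN1r dotZ mulN1r. Qed.

Lemma dot_ge0 c x : (forall i, 0 <= c i ord0) -> (forall i, 0 <= x i ord0) ->
  0 <= dot c x.
Proof. by move=> c0 x0; apply: sumr_ge0 => i _; rewrite mulr_ge0. Qed.

End dot_product.

(** * Derivatives along lines and mean values *)

Lemma is_derive_line (R : realType) (V : normedModType R) (h : V -> R) (y v : V)
    (s l : R) :
  is_derive (y + s *: v) v h l -> is_derive s (1 : R) (fun s => h (y + s *: v)) l.
Proof.
have E : (fun t : R => t^-1 *: (h (y + (t *: 1 + s) *: v) - h (y + s *: v))) =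
         (fun t : R => t^-1 *: (h (t *: v + (y + s *: v)) - h (y + s *: v))).
  apply/funext => t; congr (_ *: (h _ - _)).
  by rewrite scalerDl -[t *: 1]/(t * 1) mulr1 addrCA.
by case=> hd hv; split; rewrite ?/derivable ?/derive /= E.
Qed.

Lemma MVT_closed (R : realType) (g dg : R -> R) (a b : R) : a <= b ->
  (forall s : R, a <= s <= b -> is_derive s (1 : R) g (dg s)) ->
  exists2 c, a <= c <= b & g b - g a = dg c * (b - a).
Proof.
move=> ab gd; have [s sab||c cab gE] := @MVT_segment R g dg a b ab.
- by apply: gd; rewrite !(itvP sab).
- apply: derivable_within_continuous => s sab.
  by apply: (@ex_derive _ _ _ _ _ _ (dg s)); apply: gd; rewrite !(itvP sab).
- by exists c; rewrite ?(itvP cab).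
Qed.

Lemma MVT_centered (R : realType) (g dg : R -> R) (tau : R) :
  (forall s : R, `|s| <= `|tau| -> is_derive s (1 : R) g (dg s)) ->
  exists2 c, `|c| <= `|tau| & g tau - g 0 = dg c * tau.
Proof.
have [tau0|/ltW tau0] := leP 0 tau => gd.
  have [s /andP[s0 st]|c /andP[c0 ct]] := @MVT_closed R g dg 0 tau tau0.
    by apply: gd; rewrite !ger0_norm.
  by rewrite subr0; exists c; rewrite ?ger0_norm.
have [s /andP[st s0]|c /andP[ct c0] gE] := @MVT_closed R g dg tau 0 tau0.
  by apply: gd; rewrite !ler0_norm ?lerN2.
by exists c; rewrite ?ler0_norm ?lerN2// -opprB gE sub0r mulrN opprK.
Qed.

Lemma nbhs_norm_le (R : realType) (V : normedModType R) (x : V) (P : set V) :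
  nbhs x P -> exists2 r : R, 0 < r & forall y, `|y - x| < r -> P y.
Proof.
move=> /nbhs_ballP[r /= r0 rP]; exists r => // y yx; apply: rP.
by rewrite -ball_normE/= distrC.
Qed.

Lemma continuous_norm_lt (R : realType) (V : normedModType R) (x : V) (h : V -> R)
    (e : R) :
  {for x, continuous h} -> 0 < e ->
  exists2 r : R, 0 < r & forall y, `|y - x| < r -> `|h y - h x| < e.
Proof.
move=> hc e0; apply: nbhs_norm_le.
have /(_ _ (nbhsx_ballx (h x) e e0)) := hc; rewrite /nbhs/=.
by apply: filterS => y; rewrite /ball/= distrC.
Qed.

(** * Directional derivatives from continuous partial derivatives *)

Section calculus.
Context {R : realType} {n : nat}.
Implicit Types (h f : 'cV[R]_n -> R) (D : set 'cV[R]_n) (x y d v : 'cV[R]_n).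

Definition C1_on D h := forall x, D x -> forall j,
  derivable h x (basis_vec j) /\ {for x, continuous (partial h j)}.

Lemma C1_onP D h x j : C1_on D h -> D x ->
  is_derive x (basis_vec j) h (partial h j x).
Proof. by move=> hC1 Dx; apply: derivableP; case: (hC1 x Dx j). Qed.

Lemma line_partial D h x j s : C1_on D h -> D (x + s *: basis_vec j) ->
  is_derive s (1 : R) (fun s => h (x + s *: basis_vec j))
    (partial h j (x + s *: basis_vec j)).
Proof. by move=> hC1 Dx; apply/is_derive_line/(C1_onP _ hC1). Qed.

Lemma colE_basis d : d = \sum_j d j ord0 *: basis_vec j.
Proof.
apply/colP => i; rewrite summxE (bigD1 i)//= !mxE !eqxx mulr1 big1 ?addr0//.
by move=> j ji; rewrite !mxE eq_sym (negbTE ji) mulr0.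
Qed.

(** Coordinates are moved one at a time by the mean value theorem, and continuity at x replaces the
    partial derivatives at intermediate points by those at x. Summing over a list makes the
    induction possible. *)
Lemma partial_expansion D h x d (r : seq 'I_n) (e : R) :
  open D -> C1_on D h -> D x -> 0 < e ->
  exists2 del : R, 0 < del & forall s, `|s| < del ->
    `|h (x + s *: \sum_(j <- r) d j ord0 *: basis_vec j) - h x -
      s * \sum_(j <- r) d j ord0 * partial h j x| <= e * `|s|.
Proof.
move=> Do hC1 Dx; elim: r e => [|j r IH] e e0.
  exists 1 => // s _.
  by rewrite !big_nil scaler0 addr0 subrr mulr0 subrr normr0 mulr_ge0// ltW.
have e20 : 0 < e / 2 by rewrite divr_gt0.
have [del1 del10 H1] := IH _ e20.
set w := \sum_(j <- r) _ in H1; set dj := d j ord0.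
have a0 : 0 < e / 2 / (`|dj| + 1) by rewrite divr_gt0// ltr_wpDl.
have [_ hjc] := hC1 _ Dx j.
have [r1 r10 Hr1] := continuous_norm_lt hjc a0.
have [r2 r20 Hr2] := nbhs_norm_le (open_nbhs_nbhs (conj Do Dx)).
pose N := `|w| + `|dj| * `|basis_vec j : 'cV[R]_n| + 1.
have N0 : 0 < N by rewrite ltr_wpDl// addr_ge0// mulr_ge0.
have rho0 : 0 < Num.min r1 r2 by rewrite lt_min r10.
exists (Num.min del1 (Num.min r1 r2 / N)) => [|s].
  by rewrite lt_min del10 divr_gt0.
rewrite lt_min ltr_pdivlMr// => /andP[sd1 sN].
have near c : `|c| <= `|s * dj| ->
    `|x + s *: w + c *: basis_vec j - x| < Num.min r1 r2.
  move=> cs; apply: le_lt_trans sN.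
  rewrite [x + _]addrC addrAC addrK (le_trans (ler_normD _ _))// !normrZ.
  have : `|c| * `|basis_vec j : 'cV[R]_n| <= `|s| * (`|dj| * `|basis_vec j : 'cV[R]_n|).
    by rewrite mulrA -normrM ler_wpM2r.
  move: (normr_ge0 s); rewrite /N; nra.
have [c|c cs gE] := @MVT_centered R (fun c => h (x + s *: w + c *: basis_vec j))
    (fun c => partial h j (x + s *: w + c *: basis_vec j)) (s * dj).
  move=> cs; apply: (line_partial hC1); apply: Hr2.
  by move: (near _ cs); rewrite lt_min => /andP[].
have : `|partial h j (x + s *: w + c *: basis_vec j) - partial h j x|
         < e / 2 / (`|dj| + 1).
  by apply: Hr1; move: (near _ cs); rewrite lt_min => /andP[].
rewrite ltr_pdivlMr ?ltr_wpDl// => He.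
move: gE; rewrite scale0r addr0 => gE.
have -> : x + s *: (\sum_(i <- j :: r) d i ord0 *: basis_vec i) =
    x + s *: w + (s * dj) *: basis_vec j.
  by rewrite big_cons scalerDr scalerA addrCA addrC.
rewrite big_cons -/dj.
move: (H1 s sd1) gE He; move: (partial h j (_ + _)) => p.
set S := \sum_(j <- r) _ => H gE He.
rewrite (_ : _ - _ = (h (x + s *: w) - h x - s * S) +
   (p - partial h j x) * dj * s); last first.
  by rewrite -(subrK (h (x + s *: w)) (h (_ + _ + _))) gE; ring.
apply: le_trans (ler_normD _ _) _.
rewrite -[leRHS](_ : e / 2 * `|s| + e / 2 * `|s| = _); last by field.
apply: lerD => //; rewrite !normrM ler_wpM2r//.
apply: le_trans (ltW He); rewrite ler_wpM2l//.
by rewrite lerDl.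
Qed.

Lemma is_derive_C1 D h x d : open D -> C1_on D h -> D x ->
  is_derive x d h (\sum_j d j ord0 * partial h j x).
Proof.
move=> Do hC1 Dx; set l := \sum_j _.
have H : (fun t : R => t^-1 *: (h (t *: d + x) - h x)) @ 0^' --> l.
  apply/cvgrPdist_le => e e0.
  have [del del0 Hd] := @partial_expansion D h x d (index_enum 'I_n) e Do hC1 Dx e0.
  rewrite -colE_basis in Hd.
  near=> t.
  have t0 : t != 0 by near: t; exact: nbhs_dnbhs_neq.
  have ts : `|t| < del.
    near: t; apply: nbhs_dnbhs; apply/nbhs_ballP; exists del => //= t.
    by rewrite /ball/= sub0r normrN.
  have := Hd t ts; rewrite -/l => H.
  rewrite distrC -(ler_pM2r (_ : 0 < `|t|)) ?normr_gt0// -normrM.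
  apply: le_trans H; rewrite le_eqVlt; apply/orP; left; apply/eqP.
  rewrite [x + _]addrC -[t^-1 *: _]/(t^-1 * _); congr (`|_|).
  by field.
split; first by apply/cvg_ex; exists l.
exact/cvg_lim.
Unshelve. all: by end_near.
Qed.

End calculus.

(** * Hessians: symmetry, derivatives along lines, Cauchy-Schwarz *)

Section second_order.
Context {R : realType} {n : nat}.
Implicit Types (f : 'cV[R]_n -> R) (D : set 'cV[R]_n) (x y d v w : 'cV[R]_n).

Definition slope f d x : R := \sum_j d j ord0 * partial f j x.

Definition qform (H : 'M[R]_n) v : R := (v^T *m H *m v) ord0 ord0.

Lemma C2_C1 D f : C2_on D f -> C1_on D f.
Proof. by move=> C2 x Dx j; have [] := C2 x Dx j j. Qed.

Lemma C2_C1_partial D f j : C2_on D f -> C1_on D (partial f j).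
Proof. by move=> C2 x Dx i; have [] := C2 x Dx i j. Qed.

(** The mean value theorem is applied in direction j to the difference of f over a step in direction
    i, then in direction i to [partial f j]. This leaves [s ^+ 2] times a second partial derivative
    near x. *)
Lemma second_difference D f x i j (e : R) :
  open D -> C2_on D f -> D x -> 0 < e ->
  exists2 del : R, 0 < del & forall s, 0 < s < del ->
    `|f (x + s *: basis_vec i + s *: basis_vec j) - f (x + s *: basis_vec i)
      - f (x + s *: basis_vec j) + f x - s ^+ 2 * hess f x i j| <= e * s ^+ 2.
Proof.
move=> Do C2 Dx e0; rewrite mxE.
have [_ _ _ fijc] := C2 _ Dx i j.
have [r1 r10 Hr1] := continuous_norm_lt fijc e0.
have [r2 r20 Hr2] := nbhs_norm_le (open_nbhs_nbhs (conj Do Dx)).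
pose N := `|basis_vec i : 'cV[R]_n| + `|basis_vec j : 'cV[R]_n| + 1.
have N0 : 0 < N by rewrite ltr_wpDl// addr_ge0.
have rho0 : 0 < Num.min r1 r2 by rewrite lt_min r10.
exists (Num.min r1 r2 / N) => [|s]; first by rewrite divr_gt0.
rewrite ltr_pdivlMr// => /andP[s0 sN].
have near c c' : `|c| <= s -> `|c'| <= s ->
    `|x + c *: basis_vec i + c' *: basis_vec j - x| < Num.min r1 r2.
  move=> cs cs'; apply: le_lt_trans sN.
  rewrite [x + _]addrC addrAC addrK (le_trans (ler_normD _ _))// !normrZ.
  have := ler_wpM2r (normr_ge0 (basis_vec i : 'cV[R]_n)) cs.
  have := ler_wpM2r (normr_ge0 (basis_vec j : 'cV[R]_n)) cs'.
  by rewrite /N; nra.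
have nearD c c' : `|c| <= s -> `|c'| <= s ->
    D (x + c *: basis_vec i + c' *: basis_vec j).
  by move=> cs cs'; apply: Hr2; move: (near _ _ cs cs'); rewrite lt_min => /andP[].
have ss : `|s| = s by rewrite gtr0_norm.
have s00 : `|0 : R| <= s by rewrite normr0 ltW.
have [c|c cs gE] := @MVT_centered R
    (fun c => f (x + s *: basis_vec i + c *: basis_vec j) - f (x + c *: basis_vec j))
    (fun c => partial f j (x + s *: basis_vec i + c *: basis_vec j) -
              partial f j (x + c *: basis_vec j)) s.
  rewrite ss => cs; apply: is_deriveB; apply: (line_partial (C2_C1 C2)).
    by apply: nearD; rewrite ?ss.
  by have := nearD _ _ s00 cs; rewrite scale0r addr0.
rewrite ss in cs.
have [c'|c' cs' gE'] := @MVT_centered R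
    (fun c' => partial f j (x + c *: basis_vec j + c' *: basis_vec i))
    (fun c' => partial (partial f j) i (x + c *: basis_vec j + c' *: basis_vec i)) s.
  rewrite ss => cs'; apply: (line_partial (C2_C1_partial j C2)).
  by rewrite addrAC; apply: nearD.
rewrite ss in cs'.
have := Hr1 (x + c *: basis_vec j + c' *: basis_vec i).
have := near _ _ cs' cs.
rewrite [x + c' *: _ + _]addrAC lt_min => /andP[-> _] /(_ isT).
move: gE gE'; rewrite !scale0r !addr0 [x + c *: _ + s *: _]addrAC => gE gE'.
rewrite gE' in gE.
rewrite -[_ - _ + f x](_ : f (x + s *: basis_vec i + s *: basis_vec j) -
   f (x + s *: basis_vec j) - (f (x + s *: basis_vec i) - f x) = _); last by ring.
rewrite gE => H.
rewrite -mulrA -expr2 [_ * s ^+ 2]mulrC -mulrBr normrM ger0_norm ?sqr_ge0//.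
by rewrite mulrC ler_wpM2r ?sqr_ge0// ltW.
Qed.

(** Schwarz's theorem: the mixed second difference is symmetric in i and j, so it approximates both
    entries A and B. Tolerance |A - B| / 4 for each would give |A - B| <= |A - B| / 2. *)
Lemma hess_sym D f x : open D -> C2_on D f -> D x -> (hess f x)^T = hess f x.
Proof.
move=> Do C2 Dx; apply/matrixP => j i; rewrite mxE; apply/eqP; apply: contraT => neq.
set A := hess f x i j in neq *; set B := hess f x j i in neq *.
have e0 : 0 < `|A - B| / 4 by rewrite divr_gt0// normr_gt0 subr_eq0.
have [d1 d10 H1] := second_difference i j Do C2 Dx e0.
have [d2 d20 H2] := second_difference j i Do C2 Dx e0.
pose s := Num.min d1 d2 / 2.
have m0 : 0 < Num.min d1 d2 by rewrite lt_min d10.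
have s0 : 0 < s by rewrite divr_gt0.
have : s < Num.min d1 d2 by rewrite /s; lra.
rewrite lt_min => /andP[sd1 sd2].
have := H1 s; rewrite s0 sd1 -/A => /(_ isT).
have := H2 s; rewrite s0 sd2 -/B => /(_ isT).
rewrite [x + _ + s *: basis_vec i]addrAC.
set F1 := f (x + _ + _); set F2 := f (x + _); set F3 := f (x + s *: basis_vec i).
move=> K2 K1.
have : `|(A - B) * s ^+ 2| <= `|A - B| / 2 * s ^+ 2.
  rewrite (_ : (A - B) * _ = (F1 - F2 - F3 + f x - s ^+ 2 * B) -
     (F1 - F3 - F2 + f x - s ^+ 2 * A)); last by ring.
  apply: le_trans (ler_normB _ _) _; lra.
have s20 : 0 < s ^+ 2 by rewrite exprn_gt0.
by rewrite normrM (gtr0_norm s20) ler_pM2r//; lra.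
Qed.

Lemma is_derive_slope_line D f d x s : open D -> C1_on D f -> D (x + s *: d) ->
  is_derive s (1 : R) (fun s => f (x + s *: d)) (slope f d (x + s *: d)).
Proof. by move=> Do C1 Dx; apply/is_derive_line/(is_derive_C1 _ Do C1). Qed.

Lemma is_derive_qform_line D f d x s : open D -> C2_on D f -> D (x + s *: d) ->
  is_derive s (1 : R) (fun s => slope f d (x + s *: d))
    (qform (hess f (x + s *: d)) d).
Proof.
move=> Do C2 Dx; apply: is_derive_line; set z := x + _ in Dx *.
have H : is_derive z d (\sum_j (fun x => d j ord0 *: partial f j x))
    (\sum_j d j ord0 *: \sum_i d i ord0 * partial (partial f j) i z).
  apply: is_derive_sum => j; apply: is_deriveZ.
  exact: (is_derive_C1 d Do (C2_C1_partial j C2) Dx).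
have E : \sum_j (fun x => d j ord0 *: partial f j x) = slope f d.
  by apply/funext => y; rewrite fct_sumE.
rewrite E in H; apply: is_derive_eq H _.
rewrite /qform mxE; apply: eq_bigr => j _.
rewrite !mxE mulrC; congr (_ * _); apply: eq_bigr => i _; rewrite !mxE//.
Qed.

Lemma pos_def_unit (H : 'M[R]_n) : pos_def H -> H \in unitmx.
Proof.
move=> Hpos; rewrite unitmxE unitfE; apply/det0P => -[v v0 vH].
have vT : v^T != 0.
  by apply: contraNN v0 => /eqP/(congr1 trmx); rewrite trmxK trmx0 => ->.
by have := Hpos _ vT; rewrite trmxK vH mul0mx mxE ltxx.
Qed.

Lemma pos_def_cauchy_schwarz (H : 'M[R]_n) v w : pos_def H -> H^T = H ->
  ((v^T *m H *m w) ord0 ord0) ^+ 2 <= qform H v * qform H w.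
Proof.
move=> Hpos Hsym; have [->|v0] := eqVneq v 0.
  by rewrite /qform trmx0 !mul0mx !mxE mul0r expr0n.
set b := (v^T *m H *m w) ord0 ord0; have q0 : 0 < qform H v by exact: Hpos.
pose a := b / qform H v.
have : 0 <= qform H (w - a *: v).
  have [->|?] := eqVneq (w - a *: v) 0; first by rewrite /qform mulmx0 mxE.
  by apply/ltW/Hpos.
have bE : (w^T *m H *m v) ord0 ord0 = b.
  by rewrite /b -[in LHS](trmxK (_ *m v)) mxE !trmx_mul trmxK Hsym mulmxA.
have -> : qform H (w - a *: v) = qform H w - 2 * a * b + a ^+ 2 * qform H v.
  have subE (A B : 'M[R]_1) : (A - B) ord0 ord0 = A ord0 ord0 - B ord0 ord0.
    by rewrite !mxE.
  have scaleE (A : 'M[R]_1) : (a *: A) ord0 ord0 = a * A ord0 ord0 by rewrite mxE.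
  have trE : (w - a *: v)^T = w^T - a *: v^T by rewrite linearB linearZ.
  rewrite /qform trE !mulmxBl !mulmxBr -!scalemxAl -!scalemxAr.
  by rewrite !(subE, scaleE) bE -/b; ring.
rewrite -(pmulr_rge0 _ q0) (_ : _ * (_ + _) = qform H v * qform H w - b ^+ 2) ?subr_ge0//.
by rewrite /a; field; rewrite gt_eqF.
Qed.

End second_order.

(** * A Riccati inequality *)

Lemma is_derive_mulr (R : realType) (k s : R) :
  is_derive s (1 : R) (fun s => k * s) k.
Proof.
apply/is_derive1_caratheodory; exists (cst k); split => //; last exact: cst_continuous.
by move=> z; rewrite mulrBr.
Qed.

(* Since p' >= p^2 / Th, the function 1 / p loses at least 1 / Th on [0, 1] while
   remaining positive. *)
Lemma riccati_bound (R : realType) (p dp : R -> R) (Th : R) : 0 < Th ->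
  (forall s : R, 0 <= s <= 1 -> is_derive s (1 : R) p (dp s)) ->
  (forall s, 0 <= s <= 1 -> p s ^+ 2 <= Th * dp s) -> p 0 <= Th.
Proof.
move=> Th0 pd pdp; rewrite leNgt; apply/negP => Thp.
have dp0 s : 0 <= s <= 1 -> 0 <= dp s.
  by move=> /pdp; rewrite -(pmulr_rge0 (dp s) Th0); apply: le_trans; exact: sqr_ge0.
have ppos s : 0 <= s <= 1 -> 0 < p s.
  move=> /andP[s0 s1]; apply: lt_le_trans (lt_trans Th0 Thp) _; rewrite -subr_ge0.
  have [u /andP[u0 us]|c /andP[c0 cs] ->] := @MVT_closed R p dp 0 s s0.
    by apply: pd; rewrite u0 (le_trans us).
  by rewrite subr0 mulr_ge0// dp0// c0 (le_trans cs).
have [s s01|c c01] := @MVT_closed R (fun s => (p s)^-1)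
    (fun s => - p s ^- 2 *: dp s) 0 1 ler01.
  by apply: is_deriveV; [rewrite gt_eqF// ppos|exact: pd].
rewrite subr0 mulr1 => E.
have p10 : 0 < (p 1)^-1 by rewrite invr_gt0 ppos// ler01 lexx.
have p0Th : (p 0)^-1 < Th^-1 by rewrite ltf_pV2 ?posrE// (lt_trans Th0).
have pc := ppos _ c01.
have : Th^-1 <= p c ^- 2 * dp c.
  rewrite mulrC ler_pdivlMr ?exprn_gt0// mulrC ler_pdivrMr// mulrC; exact: pdp.
move: E; rewrite -[_ *: _]/(_ * _); lra.
Qed.

(** * Convexity of polyhedra and of their interiors *)

Section convexity.
Context {R : realType} {n : nat}.
Implicit Types (K : set 'cV[R]_n) (c x y v : 'cV[R]_n).

Lemma polyhedron_convex K x y s : polyhedron K -> K x -> K y -> 0 <= s <= 1 ->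
  K (x + s *: (y - x)).
Proof.
move=> [m [A [b ->]]] /= Kx Ky /andP[s0 s1] i.
rewrite mulmxDr -scalemxAr mulmxBr.
have := Kx i; have := Ky i; rewrite !mxE; nra.
Qed.

(** The contraction towards y by the factor 1 - s keeps points in K and maps the ball of radius r
    around x onto the ball of radius r (1 - s) around the new point. *)
Lemma polyhedron_interior_convex K x y s : polyhedron K -> (K°) x -> K y ->
  0 <= s < 1 -> (K°) (x + s *: (y - x)).
Proof.
move=> Kp xK Ky /andP[s0 s1].
have [r r0 rK] := nbhs_norm_le xK.
have s10 : 0 < 1 - s by rewrite subr_gt0.
apply/nbhs_ballP; exists (r * (1 - s)) => /=; first by rewrite mulr_gt0.
move=> z; rewrite -ball_normE/= -normrN opprB => zr.
pose w := x + (1 - s)^-1 *: (z - (x + s *: (y - x))).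
have zE : z = y + (1 - s) *: (w - y).
  rewrite /w [in RHS]scalerBr [_ *: (x + _)]scalerDr scalerA mulfV ?gt_eqF// scale1r.
  by apply/colP => i; rewrite !mxE; ring.
rewrite zE; apply: polyhedron_convex => //; last by rewrite ltW//= lerBlDr lerDl.
apply: rK; rewrite /w [x + _]addrC addrK normrZ gtr0_norm ?invr_gt0//.
by rewrite mulrC ltr_pdivrMr.
Qed.

End convexity.

(** * Consequences of the barrier inequality *)

Section barrier.
Context {R : realType} {n : nat}.
Variables (K : set 'cV[R]_n) (f : 'cV[R]_n -> R) (Th : R).
Hypotheses (Kpoly : polyhedron K) (Kge0 : forall x, K x -> forall i, 0 <= x i ord0).
Hypotheses (K0 : K 0) (fsc : self_concordant K° f) (Th1 : 1 <= Th).
Hypothesis fbar : forall x, (K°) x ->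
  local_norm f x (invmx (hess f x) *m grad f x) ^+ 2 <= Th.
Implicit Types (x y d v : 'cV[R]_n).

Let Do : open K° := open_interior K.
Let C2 : C2_on K° f. Proof. by case: fsc. Qed.
Let Hpos x : (K°) x -> pos_def (hess f x). Proof. by case: fsc => ? ? ? + ?; apply. Qed.

Lemma slopeZ a d x : slope f (a *: d) x = a * slope f d x.
Proof. by rewrite /slope mulr_sumr; apply: eq_bigr => j _; rewrite mxE mulrA. Qed.

Lemma pos_def_ge0 (H : 'M[R]_n) v : pos_def H -> 0 <= qform H v.
Proof.
move=> Hp; have [->|v0] := eqVneq v 0; first by rewrite /qform mulmx0 mxE.
exact/ltW/Hp.
Qed.

Lemma local_norm_sqr x v : (K°) x -> local_norm f x v ^+ 2 = qform (hess f x) v.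
Proof. by move=> Kx; rewrite sqr_sqrtr//; apply/pos_def_ge0/Hpos. Qed.

Lemma local_normZ a x v : local_norm f x (a *: v) = `|a| * local_norm f x v.
Proof.
have tE : (a *: v)^T = a *: v^T by rewrite linearZ.
rewrite /local_norm tE -!scalemxAl -scalemxAr scalerA mxE -expr2 sqrtrM ?sqr_ge0//.
by rewrite sqrtr_sqr.
Qed.

(** The slope is the local inner product of d with [invmx (hess f x) *m grad f x], the Newton step
    up to sign, whose squared local norm is at most [Th]. *)
Lemma barrier_cauchy_schwarz x d : (K°) x ->
  slope f d x ^+ 2 <= Th * qform (hess f x) d.
Proof.
move=> Kx; have Hu := pos_def_unit (Hpos Kx).
have := pos_def_cauchy_schwarz d (invmx (hess f x) *m grad f x) (Hpos Kx)
  (hess_sym Do C2 Kx).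
rewrite mulmxA mulmxK// [X in X ^+ 2](_ : _ = slope f d x); last first.
  by rewrite mxE; apply: eq_bigr => j _; rewrite !mxE.
move/le_trans; apply; rewrite -[X in _ * X](local_norm_sqr _ Kx) mulrC.
by apply: ler_wpM2r; [exact/pos_def_ge0/Hpos|exact: fbar].
Qed.

(** Along the segment from x to y the slope p satisfies p^2 <= Th p' by [barrier_cauchy_schwarz]. As
    y is interior, this holds up to the endpoint, and [riccati_bound] applies. *)
Lemma barrier_slope_le x y : (K°) x -> (K°) y -> slope f (y - x) x <= Th.
Proof.
move=> Kx Ky.
have KD s : 0 <= s <= 1 -> (K°) (x + s *: (y - x)).
  rewrite [s <= 1]le_eqVlt => /andP[s0 /predU1P[->|s1]].
    by rewrite scale1r addrC subrK.
  by apply: polyhedron_interior_convex => //; [exact: interior_subset|rewrite s0].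
have := @riccati_bound R (fun s => slope f (y - x) (x + s *: (y - x)))
  (fun s => qform (hess f (x + s *: (y - x))) (y - x)) Th.
rewrite scale0r addr0; apply; first by rewrite (lt_le_trans ltr01).
- by move=> s s01; apply: (is_derive_qform_line Do C2); exact: KD.
- by move=> s s01; apply: barrier_cauchy_schwarz; exact: KD.
Qed.

(* With r the left-hand side, moving from x towards y by the fraction 1 / (2 r) keeps
   the local norm of y - x above r / 2, so that the slope increases by at least r / 8,
   and barrier_slope_le bounds the slope reached. *)
Lemma barrier_local_norm_le x y : (K°) x -> (K°) y -> -1 <= slope f (y - x) x ->
  local_norm f x (y - x) <= 16 * Th + 8.
Proof.
have growth (r u sl S q : R) : u * r = 2^-1 -> 0 < u -> -1 <= sl ->
    (r / 2) ^+ 2 <= q -> S - sl = q * u -> -1 + r / 8 <= S.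
  move=> ur u0 sl1 rq E; have : (r / 2) ^+ 2 * u <= q * u by rewrite ler_pM2r.
  rewrite (_ : (r / 2) ^+ 2 * u = r / 4 * (u * r)); last by field.
  by rewrite ur; lra.
(* If r > 16 Th + 8, the slope S at the displaced point exceeds 2 Th; at least half of the way to y
   remains, so the slope towards y would exceed [Th]. *)
have absurd (r u S : R) : u <= 2^-1 -> 16 * Th + 8 < r -> -1 + r / 8 <= S ->
    (1 - u) * S <= Th -> False.
  move=> uh rbig S1 S2; have S0 : 0 < S by move: Th1; lra.
  have : 2^-1 * S <= (1 - u) * S by rewrite ler_pM2r//; lra.
  by move: Th1; lra.
move=> Kx Ky sl; rewrite leNgt; apply/negP.
set d := y - x in sl *; have [r rE] : {r | local_norm f x d = r} by eexists.
rewrite rE => rbig; have r0 : 0 < r by move: Th1; lra.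
have d0 : d != 0.
  apply: contraTneq r0 => d0.
  by rewrite -rE d0 /local_norm mulmx0 mxE sqrtr0 ltxx.
have [_ _ _ _ sc] := fsc; have [Bx sub] := sc _ Kx.
pose s0 := (2 * r)^-1.
have s00 : 0 < s0 by rewrite invr_gt0 mulr_gt0.
have s0r : s0 * r = 2^-1 by rewrite /s0; field; rewrite gt_eqF.
have s0h : s0 <= 2^-1 by move: Th1 s0r; nra.
have inB s : 0 <= s <= s0 -> local_ball f x x 1 (x + s *: d).
  move=> /andP[sge0 sle]; rewrite /local_ball/= opprD addrA subrr sub0r -scaleNr.
  rewrite local_normZ normrN ger0_norm// rE.
  apply: (@le_lt_trans _ _ (s0 * r)); first by rewrite ler_pM2r.
  by rewrite s0r; lra.
have [s ss0|c cs0] := @MVT_closed R (fun s => slope f d (x + s *: d))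
    (fun s => qform (hess f (x + s *: d)) d) 0 s0 (ltW s00).
  by apply: (is_derive_qform_line Do C2); exact/Bx/inB.
rewrite scale0r addr0 subr0 => E.
have := sub _ d (inB _ cs0) d0 => /andP[+ _].
rewrite [x + _]addrC addrK local_normZ rE ler_pdivlMr//.
have /andP[c0 cles] := cs0; rewrite ger0_norm// => Hn.
have Hn' : r / 2 <= local_norm f (x + c *: d) d.
  rewrite [x + _]addrC; apply: le_trans Hn; rewrite mulrC ler_pM2r//.
  have : c * r <= 2^-1 by rewrite -s0r ler_pM2r.
  by move: (c * r) => ?; lra.
have : (r / 2) ^+ 2 <= qform (hess f (x + c *: d)) d.
  rewrite -local_norm_sqr; last exact/Bx/inB.
  have r20 : 0 <= r / 2 by rewrite divr_ge0// ltW.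
  rewrite !expr2; exact: (ler_pM r20 r20 Hn' Hn').
move=> Hq.
have : slope f (y - (x + s0 *: d)) (x + s0 *: d) <= Th.
  by apply: barrier_slope_le => //; apply/Bx/inB; rewrite lexx ltW.
rewrite opprD addrA -/d -[X in X - _]scale1r -scalerBl slopeZ.
have : -1 + r / 8 <= slope f d (x + s0 *: d) by exact: (growth _ _ _ _ _ s0r s00 sl Hq E).
move: (slope _ _ _) => S S1 S2.
by exact: (absurd _ _ _ s0h rbig S1 S2).
Qed.

(* The point x - (y - x) / O(Th) lies in the Dikin ellipsoid of x, hence in K, and so
   has nonnegative entries. *)
Lemma barrier_dominate x y i : (K°) x -> K y -> -1 <= slope f (y - x) x ->
  y i ord0 <= (64 * Th + 33) * x i ord0.
Proof.
(* Since y may lie on the boundary of K, it is replaced by its midpoint with x. *)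
move=> Kx Ky sl; pose y' := x + 2^-1 *: (y - x).
have Ky' : (K°) y' by apply: polyhedron_interior_convex => //; lra.
have yx : y' - x = 2^-1 *: (y - x) by rewrite /y' [x + _]addrC addrK.
have N : local_norm f x (y' - x) <= 16 * Th + 8.
  by apply: barrier_local_norm_le => //; rewrite yx slopeZ; lra.
set r := 16 * Th + 8 in N; have r0 : 0 < r by rewrite /r; move: Th1; lra.
have [_ _ _ _ sc] := fsc; have [Bx _] := sc _ Kx.
(* The factor 1 / (2 r) keeps the local norm below 1. With the midpoint, entry i reads x_i - (y_i -
   x_i) / (4 r) >= 0, and 1 + 4 r = 64 Th + 33. *)
have : K (x - (2 * r)^-1 *: (y' - x)).
  apply: interior_subset; apply: Bx.
  rewrite /local_ball/= opprD addrA subrr sub0r opprK local_normZ.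
  rewrite gtr0_norm ?invr_gt0 ?mulr_gt0// mulrC ltr_pdivrMr ?mulr_gt0// mul1r.
  by apply: le_lt_trans N _; lra.
move=> /Kge0/(_ i); rewrite yx !mxE.
have -> : (2 * r)^-1 * (2^-1 * (y i ord0 - x i ord0)) = (y i ord0 - x i ord0) / (4 * r).
  by field; rewrite gt_eqF.
rewrite subr_ge0 ler_pdivrMr ?mulr_gt0// /r; lra.
Qed.

(** * Minimizers of the penalized cost *)

Variables (c : 'cV[R]_n) (eta : R) (x : 'cV[R]_n).
Hypotheses (cge0 : forall i, 0 <= c i ord0) (eta0 : 0 < eta).
Hypothesis xmin : unique_minimizer K° (fun x => eta * dot c x + f x) x.

Lemma minimizer_slope d : slope f d x = - (eta * dot c d).
Proof.
have [Kx xle] := xmin.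
have [r r0 rK] := nbhs_norm_le (open_nbhs_nbhs (conj Do Kx)).
pose e := r / (`|d| + 1).
have d10 : 0 < `|d| + 1 by rewrite ltr_wpDl.
have e0 : 0 < e by rewrite divr_gt0.
have inK s : s \in `]-e, e[ -> (K°) (x + s *: d).
  rewrite in_itv/= -ltr_norml ltr_pdivlMr// => sr; apply: rK.
  by rewrite [x + _]addrC addrK normrZ; apply: le_lt_trans sr; rewrite ler_wpM2l// lerDl.
pose g : R -> R := (fun s => f (x + s *: d)) + (fun s => eta * dot c d * s).
have gd s : s \in `]-e, e[ -> is_derive s (1 : R) g
    (slope f d (x + s *: d) + eta * dot c d).
  move=> sK; apply: is_deriveD; last exact: is_derive_mulr.
  exact: (is_derive_slope_line Do (C2_C1 C2) (inK _ sK)).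
have z0 : 0 \in `]-e, e[ by rewrite in_itv/= oppr_lt0 e0.
have : is_derive (0 : R) (1 : R) g 0.
  apply: (@derive1_at_min R g (- e) e).
  - by rewrite lerNl; move: e0; lra.
  - by move=> s sK; exact: (@ex_derive _ _ _ _ _ _ _ (gd _ sK)).
  - exact: z0.
  - move=> s /inK/xle[+ _]; rewrite dotD dotZ /g/=.
    rewrite !fctE/= scale0r addr0; lra.
move=> H; have := @derive_val _ _ _ _ _ _ _ H.
rewrite (@derive_val _ _ _ _ _ _ _ (gd _ z0)) scale0r addr0.
by move=> /eqP; rewrite addr_eq0 => /eqP.
Qed.

Lemma minimizer_cost_le : eta * dot c x <= 2 * Th.
Proof.
have [Kx _] := xmin.
(* The point 0 need not be interior, so its midpoint with x is used; hence the factor 2. *)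
have K2 : (K°) (x + 2^-1 *: (0 - x)) by apply: polyhedron_interior_convex => //; lra.
have := barrier_slope_le Kx K2.
rewrite [x + _]addrC addrK sub0r minimizer_slope scalerN -scaleNr dotZ.
lra.
Qed.

(** The slope towards y is eta (<c, x> - <c, y>), at least -1 because <c, x> is nonnegative, so
    [barrier_dominate] applies. *)
Lemma minimizer_dominate y i : K y -> eta * dot c y <= 1 ->
  y i ord0 <= (64 * Th + 33) * x i ord0.
Proof.
move=> Ky cy; have [Kx _] := xmin; apply: barrier_dominate => //.
rewrite minimizer_slope dotB.
have : 0 <= eta * dot c x.
  apply: mulr_ge0; [exact: ltW|apply: dot_ge0 => // j].
  by apply: Kge0; apply: interior_subset.
lra.
Qed.

End barrier.

(** * Logarithmic limits *)

Section tropical_exponential.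
Context {R : realType}.
Implicit Types (t r s x l : R) (u v w : \bar R).

(** Here [fine] sends +oo to 0, which is why the comparison and product rules below assume arguments
    below +oo. *)
Definition tpow t u : R := fine (epow t u).

Lemma powRE_gt1 t r : 1 < t -> t `^ r = expR (r * ln t).
Proof. by move=> t1; rewrite /powR gt_eqF// (lt_trans ltr01). Qed.

Lemma powR_gt1_gt0 t r : 1 < t -> 0 < t `^ r.
Proof. by move=> t1; rewrite powR_gt0// (lt_trans ltr01). Qed.

Lemma ler_powR_gt1 t r s : 1 < t -> (t `^ r <= t `^ s) = (r <= s).
Proof. by move=> t1; rewrite !powRE_gt1// ler_expR ler_pM2r// ln_gt0. Qed.

Lemma powR_gt1_inj t r s : 1 < t -> t `^ r = t `^ s -> r = s.
Proof.
move=> t1 E; apply/eqP; rewrite eq_le.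
by rewrite -(ler_powR_gt1 r s t1) -(ler_powR_gt1 s r t1) E lexx.
Qed.

Lemma powR_add t r s : 1 < t -> t `^ (r + s) = t `^ r * t `^ s.
Proof. by move=> t1; rewrite !powRE_gt1// mulrDl expRD. Qed.

Lemma powR_logK t x : 1 < t -> 0 < x -> t `^ (ln x / ln t) = x.
Proof.
by move=> t1 x0; rewrite powRE_gt1// divfK ?lnK ?posrE// gt_eqF// ln_gt0.
Qed.

Lemma powR_le_log t r x : 1 < t -> 0 < x -> (t `^ r <= x) = (r <= ln x / ln t).
Proof. by move=> t1 x0; rewrite -[in LHS](powR_logK t1 x0) ler_powR_gt1. Qed.

Lemma tpow_ge0 t u : 0 <= tpow t u.
Proof. by case: u => [r||]; rewrite /tpow/= ?powR_ge0. Qed.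

Lemma tpow_gt0 t u : 0 < tpow t u -> exists r, u = r%:E.
Proof. by case: u => [r||]; rewrite /tpow/= ?ltxx//; exists r. Qed.

Lemma tpow_le t u r : 1 < t -> (u < +oo)%E -> (tpow t u <= t `^ r) = (u <= r%:E)%E.
Proof.
move=> t1; case: u => [s||] //= _; rewrite /tpow/=.
  by rewrite ler_powR_gt1// lee_fin.
by rewrite powR_ge0 leNye.
Qed.

Lemma tpow_add t u v : 1 < t -> (u < +oo)%E -> (v < +oo)%E ->
  tpow t (u + v)%E = tpow t u * tpow t v.
Proof.
move=> t1; case: u => [r||]; case: v => [s||] //= _ _;
  by rewrite /tpow/= ?mulr0 ?mul0r// powR_add.
Qed.

(** Additive bounds become multiplicative ones. If x = 0, its logarithm is -oo, which forces u =
    -oo, and all terms vanish. *)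
Lemma logt_close t x u l : 1 < t -> 0 <= x -> (u < +oo)%E ->
  (logt t x - l%:E <= u <= logt t x + l%:E)%E ->
  x <= t `^ l * tpow t u /\ tpow t u <= t `^ l * x.
Proof.
move=> t1; have lt0 := ln_gt0 t1.
rewrite le_eqVlt => /predU1P[<-|x0] uoo.
  rewrite /logt le0_lneNy// mulNyr gtr0_sg ?invr_gt0// mul1e.
  by rewrite addNye leeNy_eq => /andP[_ /eqP->]; rewrite /tpow/= !mulr0 lexx.
rewrite /logt lne_EFin// -EFinM; case: u uoo => [r||]//= _.
rewrite /tpow/= -EFinB -EFinD !lee_fin => /andP[H1 H2].
rewrite -[x](powR_logK t1 x0) -!powR_add// !ler_powR_gt1//; lra.
Qed.

Lemma logt_close_sym t x u l :
  (u - l%:E <= logt t x <= u + l%:E)%E -> (logt t x - l%:E <= u <= logt t x + l%:E)%E.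
Proof. by rewrite leeBlDr// leeBlDr// andbC. Qed.

Lemma logt_eq t x r : 1 < t -> 0 <= x -> logt t x = r%:E -> x = t `^ r.
Proof.
move=> t1; have lt0 := ln_gt0 t1; rewrite le_eqVlt => /predU1P[<-|x0].
  by rewrite /logt le0_lneNy// mulNyr gtr0_sg ?invr_gt0// mul1e.
by rewrite /logt lne_EFin// -EFinM => -[<-]; rewrite powR_logK.
Qed.

Lemma epow_le t u r : 1 < t -> (epow t u <= (t `^ r)%:E)%E -> (u <= r%:E)%E.
Proof.
move=> t1; case: u => [s||] /=; rewrite ?leNye//.
by rewrite !lee_fin ler_powR_gt1.
Qed.

(** Serves to remove O(1 / log t) errors from inequalities between quantities independent of t. *)
Lemma le_of_log_bound (a b L : R) :
  (forall t, 1 < t -> a <= b + L / ln t) -> a <= b.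
Proof.
move=> H; rewrite leNgt; apply/negP => ba.
pose e := a - b; have e0 : 0 < e by rewrite subr_gt0.
pose s := (`|L| + 1) / e; have s0 : 0 < s by rewrite divr_gt0// ltr_wpDl.
have := H (expR s); rewrite expRK expR_gt1 => /(_ s0).
have : L / s < e.
  rewrite ltr_pdivrMr// /s mulrC divfK ?gt_eqF//.
  by rewrite (le_lt_trans (ler_norm _))// ltrDl.
rewrite /e; lra.
Qed.

End tropical_exponential.

(** * Distances between logarithms as multiplicative bounds *)

Section hausdorff_approximation.
Context {R : realType} {n : nat}.
Implicit Types (t kap : R) (x : 'cV[R]_n) (u v : 'cV[\bar R]_n).

(* With kap = t^l, this is d_oo (log_t x, u) <= l. *)
Definition mult_close kap t x u := forall i,
  x i ord0 <= kap * tpow t (u i ord0) /\ tpow t (u i ord0) <= kap * x i ord0.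

Lemma dinf_lt u v (l : R) : (dinf u v < l%:E)%E ->
  forall i, (u i ord0 - l%:E <= v i ord0 <= u i ord0 + l%:E)%E.
Proof.
move=> /ereal_inf_lt[_ [l' [l'0 H] <-]]; rewrite lte_fin => l'l i.
have /andP[H1 H2] := H i; apply/andP; split.
  by apply: le_trans H1; rewrite leeB// lee_fin ltW.
by apply: (le_trans H2); rewrite leeD// lee_fin ltW.
Qed.

Lemma dinf_mult_close t x u (l : R) : 1 < t -> (forall i, 0 <= x i ord0) -> tvec u ->
  (dinf (logtv t x) u < l%:E)%E -> mult_close (t `^ l) t x u.
Proof.
move=> t1 x0 uoo /dinf_lt H i; apply: logt_close => //.
by have := H i; rewrite mxE.
Qed.

Lemma dinf_mult_close_sym t x u (l : R) : 1 < t -> (forall i, 0 <= x i ord0) ->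
  tvec u -> (dinf u (logtv t x) < l%:E)%E -> mult_close (t `^ l) t x u.
Proof.
move=> t1 x0 uoo /dinf_lt H i; apply: logt_close => //; apply: logt_close_sym.
by have := H i; rewrite mxE.
Qed.

(** The distances are at most M / ln t, hence strictly below l = (|M| + 1) / ln t, and t^l = e^(|M|
    + 1) is independent of t. Strictness matters because the infima need not be attained. *)
Lemma hausdorff_mult_close (K : R -> set 'cV[R]_n) (c : R -> 'cV[R]_n)
    (KK : set 'cV[\bar R]_n) (cc : 'cV[\bar R]_n) (M : R) :
  (forall t, 1 < t -> forall x, K t x -> forall i, 0 <= x i ord0) ->
  (forall t, 1 < t -> forall i, 0 <= c t i ord0) ->
  KK `<=` tvec -> tvec cc ->
  (forall t, 1 < t ->
     (maxe (hausdorff (logtv t @` K t) KK) (dinf (logtv t (c t)) cc)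
        * (ln t)%:E <= M%:E)%E) ->
  exists2 kap, 1 <= kap & forall t, 1 < t ->
    [/\ forall x, K t x -> exists2 u, KK u & mult_close kap t x u,
        forall u, KK u -> exists2 x, K t x & mult_close kap t x u &
        mult_close kap t (c t) cc].
Proof.
move=> Kge0 cge0 KKt cct HM.
exists (expR (`|M| + 1)); first by rewrite -expR0 ler_expR addr_ge0.
move=> t t1; have lt0 := ln_gt0 t1.
pose l := (`|M| + 1) / ln t.
have -> : expR (`|M| + 1) = t `^ l by rewrite powRE_gt1// divfK// gt_eqF.
have : (maxe (hausdorff (logtv t @` K t) KK) (dinf (logtv t (c t)) cc) < l%:E)%E.
  have := HM _ t1; rewrite -lee_pdivlMr// => /le_lt_trans; apply.
  by rewrite -EFinM lte_fin ltr_pM2r ?invr_gt0// (le_lt_trans (ler_norm _))// ltrDl.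
rewrite !gt_max => /andP[/andP[H1 H2] H3]; split.
- move=> x Kx; have : (dinf_set (logtv t x) KK < l%:E)%E.
    by apply: le_lt_trans H1; apply: ereal_sup_ubound; exists (logtv t x) => //; exists x.
  move=> /ereal_inf_lt[_ [u KKu <-]] ul; exists u => //.
  exact: dinf_mult_close t1 (Kge0 _ t1 _ Kx) (KKt _ KKu) ul.
- move=> u KKu; have : (dinf_set u (logtv t @` K t) < l%:E)%E.
    by apply: le_lt_trans H2; apply: ereal_sup_ubound; exists u.
  move=> /ereal_inf_lt[_ [_ [x Kx <-] <-]] ul; exists x => //.
  exact: dinf_mult_close_sym t1 (Kge0 _ t1 _ Kx) (KKt _ KKu) ul.
- exact: dinf_mult_close t1 (cge0 _ t1) cct H3.
Qed.

Lemma tdot_le t (cc u : 'cV[\bar R]_n) (r : R) : 1 < t -> tvec cc -> tvec u ->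
  (tdot cc u <= r%:E)%E <->
  forall i, tpow t (cc i ord0) * tpow t (u i ord0) <= t `^ r.
Proof.
move=> t1 cct ut; have uoo i : (cc i ord0 + u i ord0 < +oo)%E.
  by rewrite lte_add_pinfty.
split=> [/bigmax_leP[_ H] i|H].
  by rewrite -tpow_add// tpow_le// H.
apply/bigmax_leP; split; first exact: leNye.
by move=> i _; rewrite -(tpow_le _ t1)// tpow_add.
Qed.

End hausdorff_approximation.

(** * Approximate tropical segments *)

Section tropical_chain.
Context {R : realType} {n : nat}.
Variable rho : 'I_n -> R -> R.
Hypothesis rho_nincr : forall i lambda mu, lambda <= mu -> rho i mu <= rho i lambda.
Hypothesis rho_lip : forall i lambda mu, lambda <= mu ->
  rho i lambda - (mu - lambda) <= rho i mu.
Implicit Types (a b l lambda mu nu e : R) (i : 'I_n).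

(* The piece of the path between the levels mu and nu is a tropical segment up to e.
   The reverse inequality and the levels outside [mu, nu] come for free from
   rho_nincr and rho_lip, and quantifying over all levels makes the property stable
   under moving mu and nu. *)
Definition near_tsegm mu nu e := forall i lambda,
  rho i lambda <= Num.max (rho i mu - (lambda - mu)) (rho i nu) + e.

Definition near_tsegm_chain a b e (p : nat) (mu : nat -> R) :=
  [/\ mu 0%N = a, mu p = b &
      forall j, (j < p)%N -> mu j <= mu j.+1 /\ near_tsegm (mu j) (mu j.+1) e].

Lemma rho_dist i mu nu e : `|mu - nu| <= e -> rho i mu <= rho i nu + e.
Proof.
have [mn|/ltW nm] := leP mu nu.
  by rewrite ler0_norm ?subr_le0// => H; have := rho_lip i mn; lra.
by rewrite ger0_norm ?subr_ge0// => H; have := rho_nincr i nm; lra.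
Qed.

Lemma near_tsegm_refl mu e : 0 <= e -> near_tsegm mu mu e.
Proof.
move=> e0 i lambda; have [lm|/ltW ml] := leP lambda mu.
  have := rho_lip i lm; rewrite -lerBlDr le_max => H.
  by apply/orP; left; lra.
have := rho_nincr i ml; rewrite -lerBlDr le_max => H.
by apply/orP; right; lra.
Qed.

(** Moving the ends inwards only raises the right-hand side: [rho_lip] handles the left end,
    [rho_nincr] the right one. *)
Lemma near_tsegm_sub l l' mu nu e : l <= mu -> nu <= l' ->
  near_tsegm l l' e -> near_tsegm mu nu e.
Proof.
move=> lm nl H i lambda; apply: le_trans (H i lambda) _; rewrite lerD2r ge_max !le_max.
have := rho_lip i lm; have := rho_nincr i nl => H1 H2.
by apply/andP; split; apply/orP; [left; lra|right].
Qed.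

Lemma near_tsegm_inside mu nu e : 0 <= e ->
  (forall i lambda, mu <= lambda <= nu ->
    rho i lambda <= Num.max (rho i mu - (lambda - mu)) (rho i nu) + e) ->
  near_tsegm mu nu e.
Proof.
move=> e0 H i lambda; have [lm|ml] := leP lambda mu.
  rewrite -lerBlDr le_max; have := rho_lip i lm => ?.
  by apply/orP; left; lra.
have [ln|nl] := leP lambda nu; first by apply: H; rewrite ltW.
rewrite -lerBlDr le_max; have := rho_nincr i (ltW nl) => ?.
by apply/orP; right; lra.
Qed.

(** One e is the error already present, one comes from [rho] at the moved ends, one from the shift
    of mu in lambda - mu. *)
Lemma near_tsegm_perturb mu nu mu' nu' e : `|mu - mu'| <= e -> `|nu - nu'| <= e ->
  near_tsegm mu' nu' e -> near_tsegm mu nu (3 * e).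
Proof.
move=> me ne H i lambda; apply: le_trans (H i lambda) _.
have := rho_dist i (etrans (congr1 (<=%R^~ e) (distrC mu' mu)) me).
have := rho_dist i (etrans (congr1 (<=%R^~ e) (distrC nu' nu)) ne).
move: me ne; rewrite !ler_norml => /andP[m1 m2] /andP[n1 n2] H1 H2.
rewrite -lerBrDr ge_max; apply/andP; split; rewrite -addrA -lerBlDr le_max;
  apply/orP; [left|right]; lra.
Qed.

Lemma near_tsegm_limit mu nu : (forall e, 0 < e -> near_tsegm mu nu (3 * e)) ->
  near_tsegm mu nu 0.
Proof.
move=> H i lambda; apply/ler_addgt0Pr => e e0.
have e30 : 0 < e / 3 by rewrite divr_gt0.
apply: le_trans (H _ e30 i lambda) _.
by rewrite addr0 lerD2l mulrC divfK.
Qed.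

(** Compactness: the vertices of all chains lie in [a, b]. A cluster point as e tends to 0 is, for
    every e, within e of some chain with error e, and perturbation followed by a limit makes it a
    chain without error. *)
Lemma near_tsegm_chain_limit a b (p : nat) :
  (forall e, 0 < e -> exists ch, near_tsegm_chain a b e p ch) ->
  exists ch, near_tsegm_chain a b 0 p ch.
Proof.
move=> H.
pose S e := [set v : 'rV[R]_p.+1 | near_tsegm_chain a b e p (fun j => v ord0 (inord j))].
(* This filter plays the role of a sequence of chains with errors tending to 0. *)
pose F := filter_from [set e : R | 0 < e] S.
have SF e : 0 < e -> S e !=set0.
  move=> /H[mu [mu0 mup muS]]; exists (\row_j mu j); rewrite /S/=.
  have E j : (j <= p)%N -> (\row_(k < p.+1) mu k) ord0 (inord j) = mu j.
    by move=> jp; rewrite mxE inordK.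
  by split; rewrite ?E// => j jp; rewrite !E ?(ltnW jp)//; exact: muS.
have Sle e e' : e <= e' -> S e `<=` S e'.
  move=> ee v [v0 vp vS]; split=> // j jp; have [? Hj] := vS j jp; split=> // i l.
  by apply: le_trans (Hj i l) _; rewrite lerD2l.
have FF : ProperFilter F.
  apply: filter_from_proper => //; apply: filter_from_filter; first by exists 1 => /=.
  move=> e e' /= e0 e'0; exists (Num.min e e'); first by rewrite /= lt_min e0.
  by move=> v vS; split; apply: Sle vS; rewrite ge_min lexx ?orbT.
pose A (j : 'I_p.+1) := [set` `[a, b]].
have Acomp : compact [set v : 'rV[R]_p.+1 | forall j, A j (v ord0 j)].
  by apply: rV_compact => j; exact: segment_compact.
have FA : F [set v : 'rV[R]_p.+1 | forall j, A j (v ord0 j)].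
  exists 1 => //= v [v0 vp vS] j.
  have mono k m : (k + m <= p)%N -> v ord0 (inord k) <= v ord0 (inord (k + m)).
    elim: m => [|m IH]; first by rewrite addn0.
    rewrite addnS => km; apply: le_trans (IH (ltnW km)) _.
    by have [] := vS _ km.
  have jp : (j <= p)%N by rewrite -ltnS.
  rewrite /A/= in_itv/= -v0 -vp; apply/andP; split.
    by have := mono 0%N j; rewrite add0n inord_val; apply.
  by have := mono j (p - j)%N; rewrite subnKC// inord_val; apply.
have [v [_ vF]] := Acomp F FF FA.
have vnear e : 0 < e -> exists2 w, S e w & forall j, `|v ord0 j - w ord0 j| <= e.
  move=> e0; have [||w [Sw wv]] := vF (S e) (ball v e).
  - by exists e.
  - exact: nbhsx_ballx.
  - by exists w => // j; have [_ wj] := wv; have := wj ord0 j; rewrite /ball/= => /ltW.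
exists (fun j => v ord0 (inord j)); split.
- apply/eqP; rewrite -subr_eq0 -normr_le0; apply/ler_addgt0Pr => e e0.
  by rewrite add0r; have [w [<- _ _] /(_ (inord 0))] := vnear _ e0.
- apply/eqP; rewrite -subr_eq0 -normr_le0; apply/ler_addgt0Pr => e e0.
  by rewrite add0r; have [w [_ <- _] /(_ (inord p))] := vnear _ e0.
move=> j jp; split.
  apply/ler_addgt0Pr => e e0; have e20 : 0 < e / 2 by rewrite divr_gt0.
  have [w [_ _ /(_ j jp)[wj _]] wv] := vnear _ e20.
  have := wv (inord j); have := wv (inord j.+1); rewrite !ler_norml; lra.
apply: near_tsegm_limit => e e0; have [w [_ _ /(_ j jp)[_ wj]] wv] := vnear _ e0.
exact: near_tsegm_perturb wj.
Qed.

(* The levels l of the vertices may go back and forth and exceed b. Their running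
   maximum, truncated at b, is a monotone chain from a to b, each nontrivial step of
   which is contained in an ascending step of l. *)
Lemma near_tsegm_chain_monotone a b e (p : nat) (l : nat -> R) :
  0 <= e -> a <= b -> l 0%N = a -> l p = b ->
  (forall j, (j < p)%N -> l j <= l j.+1 -> near_tsegm (l j) (l j.+1) e) ->
  exists ch, near_tsegm_chain a b e p ch.
Proof.
move=> e0 ab l0 lp H.
pose mu := fix mu j := if j is j'.+1 then Num.max (mu j') (Num.min (l j'.+1) b) else a.
have mub j : mu j <= b by elim: j => //= j IH; rewrite ge_max IH ge_min lexx orbT.
have lmu j : Num.min (l j) b <= mu j.
  by case: j => [|j] /=; [rewrite l0 ge_min lexx|rewrite le_max lexx orbT].
exists mu; split=> //.
  by apply/eqP; rewrite eq_le mub; have := lmu p; rewrite lp minxx.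
move=> j jp; split; first by rewrite /= le_max lexx.
rewrite /=; have [m|m] := leP (Num.min (l j.+1) b) (mu j).
  exact: near_tsegm_refl.
move: (m); rewrite lt_min => /andP[ml mb].
have lj : l j <= mu j by have := lmu j; rewrite ge_min (leNgt b) mb orbF.
apply: near_tsegm_sub (H j jp _) => //; first by rewrite ge_min lexx.
by apply: le_trans lj _; exact: ltW.
Qed.

(** * Chains without error as tropical segments *)

Variable P : R -> 'cV[\bar R]_n.
Hypothesis PE : forall lambda i, P lambda i ord0 = (rho i lambda)%:E.

(** Level lambda corresponds to the weights l = mu - lambda and m = 0. Weights l < mu - nu add
    nothing beyond [P nu], which then dominates; for m < 0, l is 0 and [P mu] dominates. *)
Lemma near_tsegm_image mu nu : mu <= nu -> near_tsegm mu nu 0 ->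
  P @` `[mu, nu] = tsegm (P mu) (P nu).
Proof.
move=> mn H.
have pathE lambda : mu <= lambda -> lambda <= nu -> P lambda =
    \col_i maxe (P mu i ord0 + (- (lambda - mu))%:E) (P nu i ord0).
  move=> ml ln; apply/colP => i; rewrite mxE !PE -EFinD -EFin_max; congr EFin.
  apply/eqP; rewrite eq_le; have := H i lambda; rewrite addr0 => ->.
  by rewrite ge_max rho_lip// rho_nincr.
apply/seteqP; split=> [_ [lambda + <-]|_ [l [m [lm0 ->]]]].
  rewrite /= in_itv/= => /andP[ml ln]; exists (- (lambda - mu))%:E, 0%E; split.
    by apply/max_idPr; rewrite lee_fin oppr_le0 subr_ge0.
  by rewrite [LHS]pathE//; apply/colP => i; rewrite !mxE adde0.
have munuE : P nu = \col_i maxe (P mu i ord0 + (- (nu - mu))%:E) (P nu i ord0).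
  exact: pathE.
have [l0 m0] : (l <= 0 /\ m <= 0)%E by rewrite -lm0 !le_max !lexx orbT.
have [m00|m00] := eqVneq m 0%E.
  rewrite m00; case: l l0 {lm0} => [s||] //=.
  - rewrite lee_fin => s0; have [sn|ns] := leP (mu - s) nu.
      exists (mu - s); first by rewrite /= in_itv/= sn andbT lerDl oppr_ge0.
      rewrite pathE ?lerDl ?oppr_ge0//; apply/colP => i; rewrite !mxE adde0.
      by congr (maxe (_ + _%:E) _); ring.
    exists nu; first by rewrite /= in_itv/= mn lexx.
    apply/colP => i; rewrite mxE adde0 !PE -EFinD -EFin_max; congr EFin.
    apply/esym/max_idPr; have := rho_lip i mn; lra.
  - move=> _; exists nu; first by rewrite /= in_itv/= mn lexx.
    by apply/colP => i; rewrite mxE adde0 !PE /= maxNye.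
have -> : l = 0%E.
  by move: lm0; rewrite /Order.max; case: ifP => // _ m0'; rewrite m0' eqxx in m00.
exists mu; first by rewrite /= in_itv/= mn lexx.
apply/colP => i; rewrite mxE adde0; apply/esym/max_idPl; rewrite !PE.
apply: (@le_trans _ _ (rho i nu)%:E); last by rewrite lee_fin rho_nincr.
by rewrite geeDl.
Qed.

Lemma near_tsegm_chain_complexity a b (p : nat) (ch : nat -> R) :
  near_tsegm_chain a b 0 p ch -> tsegm_decomposition P a b p.
Proof.
move=> [ch0 chp chS]; exists ch; split=> // j jp.
by have [mm H] := chS j jp; split=> //; exact: near_tsegm_image.
Qed.

(** If p pieces admit no exact decomposition, [near_tsegm_chain_limit] yields an error for which no
    chain exists; a minimum over p <= p0 is taken. *)
Lemma tsegm_decomposition_stable a b (p0 : nat) :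
  exists2 e, 0 < e & forall p, (p <= p0)%N ->
    (exists ch, near_tsegm_chain a b e p ch) -> tsegm_decomposition P a b p.
Proof.
have step p : exists2 e, 0 < e &
    (exists ch, near_tsegm_chain a b e p ch) -> tsegm_decomposition P a b p.
  have [D|D] := pselect (tsegm_decomposition P a b p); first by exists 1.
  have /existsNP[e /not_implyP[e0 ne]] :
      ~ forall e, 0 < e -> exists ch, near_tsegm_chain a b e p ch.
    by move=> /near_tsegm_chain_limit[mu /near_tsegm_chain_complexity].
  by exists e.
elim: p0 => [|p0 [e e0 IH]].
  by have [e e0 H] := step 0%N; exists e => // p; rewrite leqn0 => /eqP->.
have [e' e'0 H] := step p0.+1.
have chain_le d d' p : d <= d' -> (exists ch, near_tsegm_chain a b d p ch) ->
    exists ch, near_tsegm_chain a b d' p ch.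
  move=> dd [mu [m0 mp mS]]; exists mu; split=> // j jp.
  have [? Hj] := mS j jp; split=> // i l.
  by apply: le_trans (Hj i l) _; rewrite lerD2l.
exists (Num.min e e') => [|p]; first by rewrite lt_min e0.
rewrite leq_eqVlt ltnS => /predU1P[->|pp0] Hc.
  by apply/H/(chain_le _ _ _ _ Hc); rewrite ge_min lexx orbT.
by apply/(IH _ pp0)/(chain_le _ _ _ _ Hc); rewrite ge_min lexx.
Qed.

End tropical_chain.

(** * The tropical central path *)

Section central_path_limit.
Context {R : realType} {n : nat}.
Variables (K : R -> set 'cV[R]_n) (c : R -> 'cV[R]_n) (C : R -> R -> 'cV[R]_n).
Variables (KK : set 'cV[\bar R]_n) (cc : 'cV[\bar R]_n) (kap G B : R).
Hypotheses (KKt : KK `<=` tvec) (cct : tvec cc).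
Hypothesis Kge0 : forall t, 1 < t -> forall x, K t x -> forall i, 0 <= x i ord0.
Hypothesis Kscale : forall t, 1 < t -> forall x s, K t x -> 0 <= s <= 1 -> K t (s *: x).
Hypothesis cge0 : forall t, 1 < t -> forall i, 0 <= c t i ord0.
Hypotheses (kap1 : 1 <= kap) (G1 : 1 <= G) (B1 : 1 <= B).
Hypothesis Kapprox : forall t, 1 < t ->
  [/\ forall x, K t x -> exists2 u, KK u & mult_close kap t x u,
      forall u, KK u -> exists2 x, K t x & mult_close kap t x u &
      mult_close kap t (c t) cc].
Hypothesis CK : forall t eta, 1 < t -> 0 < eta -> K t (C t eta).
Hypothesis C_gt0 : forall t eta, 1 < t -> 0 < eta -> forall i, 0 < C t eta i ord0.
Hypothesis Ccost : forall t eta, 1 < t -> 0 < eta -> eta * dot (c t) (C t eta) <= G.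
Hypothesis Cdom : forall t eta, 1 < t -> 0 < eta -> forall y, K t y ->
  eta * dot (c t) y <= 1 -> forall i, y i ord0 <= B * C t eta i ord0.
Hypothesis KKbnd : forall lambda : R, bounded_from_above (tsublevel KK cc lambda).
Implicit Types (t lambda mu nu : R) (i : 'I_n).

Let kap0 : 0 < kap. Proof. exact: lt_le_trans ltr01 kap1. Qed.
Let G0 : 0 < G. Proof. exact: lt_le_trans ltr01 G1. Qed.
Let B0 : 0 < B. Proof. exact: lt_le_trans ltr01 B1. Qed.

Lemma dot_term_le t x i : 1 < t -> K t x -> c t i ord0 * x i ord0 <= dot (c t) x.
Proof.
move=> t1 Kx; rewrite /dot (bigD1 i)//= lerDl; apply: sumr_ge0 => j _.
by rewrite mulr_ge0// ?cge0// (Kge0 t1 Kx).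
Qed.

Lemma tcost_close t x u i : 1 < t -> K t x -> mult_close kap t x u ->
  tpow t (cc i ord0) * tpow t (u i ord0) <= kap ^+ 2 * (c t i ord0 * x i ord0) /\
  c t i ord0 * x i ord0 <= kap ^+ 2 * (tpow t (cc i ord0) * tpow t (u i ord0)).
Proof.
move=> t1 Kx xu; have [_ _ ccl] := Kapprox t1.
have [x1 x2] := xu i; have [c1 c2] := ccl i.
split; rewrite expr2 mulrACA; apply: ler_pM => //; rewrite ?tpow_ge0 ?cge0//.
exact: (Kge0 t1 Kx).
Qed.

(** The central point is divided by G kap^2: G brings its cost below t^-lambda, and kap^2 pays for
    the passage to the tropical cost. The third kap comes from comparing entries with those of u. *)
Lemma central_path_below t lambda : 1 < t ->
  exists2 u, tsublevel KK cc lambda u &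
    forall i, C t (t `^ lambda) i ord0 <= G * kap ^+ 3 * tpow t (u i ord0).
Proof.
move=> t1; set x := C t _; have e0 := powR_gt1_gt0 lambda t1.
pose k := G * kap ^+ 2; have k0 : 0 < k by rewrite mulr_gt0// exprn_gt0.
have k1 : 1 <= k by rewrite mulr_ege1// exprn_ege1.
have Kx : K t (k^-1 *: x).
  by apply: Kscale; [|exact: CK|rewrite invr_ge0 ltW//= invf_le1].
have [H _ _] := Kapprox t1; have [u KKu xu] := H _ Kx.
exists u; last first.
  move=> i; have [+ _] := xu i; rewrite mxE -(ler_pM2l k0) mulrA mulfV ?gt_eqF//.
  by rewrite mul1r /k exprS => /le_trans; apply; rewrite le_eqVlt; apply/orP; left; apply/eqP; ring.
split=> //; rewrite -[(- _)%E]/((- lambda)%:E) (tdot_le _ t1)//; last exact: KKt.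
move=> i; have [+ _] := tcost_close i t1 Kx xu; move/le_trans; apply.
rewrite mxE powRN -[leRHS]div1r ler_pdivlMr//.
have -> : kap ^+ 2 * (c t i ord0 * (k^-1 * x i ord0)) = c t i ord0 * x i ord0 / G.
  by rewrite /k; field; rewrite !gt_eqF.
rewrite mulrAC ler_pdivrMr// mul1r; apply: le_trans (Ccost t1 e0).
by rewrite mulrC ler_pM2l// dot_term_le//; exact: CK.
Qed.

(** A real point close to u has cost at most n kap^2 t^-lambda, a sum of n terms; divided by k it
    falls under [Cdom]. Taking [n.+1] keeps k >= 1 when n = 0. *)
Lemma central_path_above t lambda u i : 1 < t -> tsublevel KK cc lambda u ->
  tpow t (u i ord0) <= n.+1%:R * kap ^+ 3 * B * C t (t `^ lambda) i ord0.
Proof.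
move=> t1 [KKu]; rewrite -[(- _)%E]/((- lambda)%:E) (tdot_le _ t1)//; last exact: KKt.
move=> Hu; have [_ H _] := Kapprox t1; have [y Ky yu] := H _ KKu.
have e0 := powR_gt1_gt0 lambda t1.
pose k := n.+1%:R * kap ^+ 2; have k0 : 0 < k by rewrite mulr_gt0// exprn_gt0.
have k1 : 1 <= k by rewrite mulr_ege1// ?exprn_ege1// ler1n.
have Ky' : K t (k^-1 *: y).
  by apply: Kscale => //; rewrite invr_ge0 ltW//= invf_le1.
have : dot (c t) y <= n%:R * (kap ^+ 2 * t `^ (- lambda)).
  have : dot (c t) y <= \sum_(j < n) kap ^+ 2 * t `^ (- lambda).
    apply: ler_sum => j _; have [_ +] := tcost_close j t1 Ky yu.
    by move/le_trans; apply; rewrite ler_pM2l ?exprn_gt0.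
  by rewrite sumr_const card_ord mulr_natl.
rewrite powRN => Hd.
have : t `^ lambda * dot (c t) (k^-1 *: y) <= 1.
  rewrite dotZ mulrCA ler_pdivrMl// mulr1 /k.
  apply: le_trans (_ : n%:R * kap ^+ 2 <= _); last first.
    by rewrite ler_pM2r ?exprn_gt0// ler_nat.
  rewrite -ler_pdivlMl//; apply: le_trans Hd _.
  by rewrite le_eqVlt; apply/orP; left; apply/eqP; field; rewrite gt_eqF.
move=> /(Cdom t1 e0 Ky')/(_ i); rewrite mxE ler_pdivrMl// => Hy.
have [_ +] := yu i; move/le_trans; apply.
rewrite -(ler_pM2l kap0) in Hy; apply: (le_trans Hy).
by rewrite /k le_eqVlt; apply/orP; left; apply/eqP; ring.
Qed.

(** * Entries of the tropical central path as functions of the level *)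

Definition trop_coord i lambda : R := fine (tcentral_path KK cc lambda i ord0).

(** The entry is finite: positivity of the central path at any t, here 2, gives a point of the
    sublevel set whose entry i is finite, and [KKbnd] bounds the supremum from above. *)
Lemma tcentral_pathE i lambda :
  tcentral_path KK cc lambda i ord0 = (trop_coord i lambda)%:E.
Proof.
rewrite /trop_coord fineK// mxE fin_numE; apply/andP; split.
  have t1 : 1 < 2 :> R by rewrite ltr1n.
  have [u uS Hu] := central_path_below lambda t1.
  have : 0 < tpow 2 (u i ord0).
    have := lt_le_trans (C_gt0 t1 (powR_gt1_gt0 lambda t1) i) (Hu i).
    by rewrite pmulr_rgt0// mulr_gt0// exprn_gt0.
  move=> /tpow_gt0[r ur]; rewrite -ltNye; apply: (@lt_le_trans _ _ (u i ord0)).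
    by rewrite ur ltNyr.
  by apply: ereal_sup_ubound; exists u.
have [M HM] := KKbnd lambda; rewrite -ltey; apply: (@le_lt_trans _ _ M%:E).
  by apply: ge_ereal_sup => _ [u uS <-]; exact: HM.
exact: ltry.
Qed.

Lemma tsublevel_le_trop_coord u i lambda : tsublevel KK cc lambda u ->
  (u i ord0 <= (trop_coord i lambda)%:E)%E.
Proof.
by move=> uS; rewrite -tcentral_pathE mxE; apply: ereal_sup_ubound; exists u.
Qed.

Lemma trop_coord_le i lambda (r : R) :
  (forall u, tsublevel KK cc lambda u -> (u i ord0 <= r%:E)%E) -> trop_coord i lambda <= r.
Proof.
move=> H; rewrite -lee_fin -tcentral_pathE mxE.
by apply: ge_ereal_sup => _ [u uS <-]; exact: H.
Qed.

Lemma trop_coord_nincr i lambda mu : lambda <= mu -> trop_coord i mu <= trop_coord i lambda.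
Proof.
move=> lm; apply: trop_coord_le => u [KKu uc]; apply: tsublevel_le_trop_coord.
by split=> //; apply: le_trans uc _; rewrite leeN2 lee_fin.
Qed.

(** Up to O(1 / log t), lowering u by mu - lambda in all entries stays in [KK]: a nearby point of
    [K t] is scaled by t^-(mu - lambda). The claim does not involve t, so the error disappears by
    [le_of_log_bound]. *)
Lemma trop_coord_lipschitz i lambda mu : lambda <= mu ->
  trop_coord i lambda - (mu - lambda) <= trop_coord i mu.
Proof.
move=> lm; rewrite lerBlDr; apply: trop_coord_le => u [KKu uc].
have uoo : (u i ord0 < +oo)%E by exact: KKt.
case ur : (u i ord0) uoo => [r||]// _; last by rewrite leNye.
rewrite lee_fin -lerBlDr; apply: (@le_of_log_bound _ _ _ (ln (kap ^+ 6))) => t t1.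
have kn m : 0 < kap ^+ m by rewrite exprn_gt0.
have [H1 H2 _] := Kapprox t1; have [y Ky yu] := H2 _ KKu.
set p := t `^ (- (mu - lambda)); have p0 : 0 < p by exact: powR_gt1_gt0.
have p1 : p <= 1 by rewrite -(powRr0 t) ler_powR_gt1// oppr_le0 subr_ge0.
(* The factor kap^-4 absorbs two losses of kap^2 between real and tropical costs, so that u' has
   tropical cost at most -mu. *)
pose k := kap ^- 4 * p.
have k0 : 0 < k by rewrite mulr_gt0// invr_gt0.
have Ky' : K t (k *: y).
  apply: Kscale => //; rewrite ltW//=; apply: mulr_ile1 => //.
  - by rewrite invr_ge0 ltW.
  - exact: ltW.
  - by rewrite invf_le1// exprn_ege1.
have [u' KKu' yu'] := H1 _ Ky'.
have u'S : tsublevel KK cc mu u'.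
  split=> //; rewrite -[(- _)%E]/((- mu)%:E) (tdot_le _ t1)//; last exact: KKt.
  move=> j; have [+ _] := tcost_close j t1 Ky' yu'; move/le_trans; apply.
  move: uc; rewrite -[(- _)%E]/((- lambda)%:E) (tdot_le _ t1)//; last exact: KKt.
  move=> /(_ j) uj; have [_ cy] := tcost_close j t1 Ky yu.
  have {uj} cy' : c t j ord0 * y j ord0 <= kap ^+ 2 * t `^ (- lambda).
    by apply: le_trans cy _; rewrite ler_pM2l.
  rewrite (_ : - mu = - (mu - lambda) + - lambda); last by ring.
  rewrite powR_add// -/p mxE.
  rewrite (_ : kap ^+ 2 * _ = kap ^- 2 * p * (c t j ord0 * y j ord0)); last first.
    by rewrite /k; field; rewrite gt_eqF.
  by rewrite -mulrA ler_pdivrMl// [leRHS]mulrCA ler_pM2l.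
have := tsublevel_le_trop_coord i u'S; rewrite -(tpow_le _ t1)//; last exact: KKt.
move=> u'i; have [+ _] := yu' i; have [_] := yu i.
rewrite ur /tpow/= -/(tpow _ _) mxE => yr yu'i.
rewrite -(ler_powR_gt1 _ _ t1) !powR_add// powR_logK//.
have e : t `^ r * p <= kap ^+ 5 * (k * y i ord0).
  have -> : kap ^+ 5 * (k * y i ord0) = kap * y i ord0 * p.
    by rewrite /k; field; rewrite gt_eqF.
  by rewrite ler_pM2r.
apply: (le_trans e); rewrite [leRHS]mulrC (exprSr kap 5) -[leRHS]mulrA ler_pM2l//.
by apply: (le_trans yu'i); rewrite ler_pM2l.
Qed.

Lemma central_path_close : exists2 L, 1 <= L & forall t lambda i, 1 < t ->
  C t (t `^ lambda) i ord0 <= L * t `^ trop_coord i lambda /\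
  t `^ trop_coord i lambda <= L * C t (t `^ lambda) i ord0.
Proof.
have k3 : 1 <= kap ^+ 3 by rewrite exprn_ege1.
have k30 : 0 < kap ^+ 3 by rewrite exprn_gt0.
have n1 : 1 <= n.+1%:R :> R by rewrite ler1n.
exists (n.+1%:R * kap ^+ 3 * B * G); first by do ![apply: mulr_ege1 => //].
move=> t lambda i t1; have C0 := C_gt0 t1 (powR_gt1_gt0 lambda t1) i.
have p0 := powR_gt1_gt0 (trop_coord i lambda) t1; split.
  have [u uS Hu] := central_path_below lambda t1.
  apply: le_trans (Hu i) _; apply: ler_pM; rewrite ?tpow_ge0//.
  - by rewrite ltW// mulr_gt0.
  - rewrite mulrC ler_pM2r// -mulrA mulrCA ler_peMr ?(ltW k30)//.
    exact: mulr_ege1.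
  - rewrite tpow_le//; first exact: tsublevel_le_trop_coord.
    by case: uS => /KKt/(_ i).
have X0 : 0 < n.+1%:R * kap ^+ 3 * B * C t (t `^ lambda) i ord0 by rewrite !mulr_gt0.
apply: (@le_trans _ _ (n.+1%:R * kap ^+ 3 * B * C t (t `^ lambda) i ord0)).
  rewrite powR_le_log//; apply: trop_coord_le => u uS.
  rewrite -(tpow_le _ t1); last by case: uS => /KKt/(_ i).
  by rewrite powR_logK//; exact: central_path_above.
by rewrite ler_pM2r// ler_peMr// !mulr_ge0// ltW.
Qed.

(* The assumption on lambda provides points of K t whose cost is of order at least
   t^-lambda; scaled down to cost at most t^-lambda, they are dominated by the
   central path. *)
Lemma central_cost_ge t lambda : 1 < t ->
  (- lambda%:E <= ereal_sup [set tdot cc x | x in KK])%E ->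
  t `^ (- lambda) <= expR 1 * kap ^+ 2 * B * dot (c t) (C t (t `^ lambda)).
Proof.
move=> t1 Hl; have lt0 := ln_gt0 t1; have e0 := powR_gt1_gt0 lambda t1.
have k20 : 0 < kap ^+ 2 by rewrite exprn_gt0.
have k2 : 1 <= kap ^+ 2 by rewrite exprn_ege1.
have E1 : 1 <= expR 1 :> R by rewrite -[leLHS]expR0 ler_expR.
have E0 : 0 < expR 1 :> R := expR_gt0 _.
(* The supremum need not be attained; going down by 1 / ln t costs only the factor t^(1 / ln t) = e,
   whence [expR 1]. *)
pose r := - lambda - 1 / ln t.
have : (r%:E < ereal_sup [set tdot cc x | x in KK])%E.
  by apply: lt_le_trans Hl; rewrite -EFinN lte_fin /r ltrBlDr ltrDl divr_gt0.
move=> /ereal_sup_gt[_ [v KKv <-]]; rewrite ltNge => /negP Hv.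
have [i Hi] : exists i, t `^ r < tpow t (cc i ord0) * tpow t (v i ord0).
  apply: contra_notP Hv => /forallNP Hv; apply/(tdot_le _ t1) => //; first exact: KKt.
  by move=> i; rewrite leNgt; apply/negP.
have rE : t `^ r = t `^ (- lambda) / expR 1.
  by rewrite /r powR_add// (powRN _ (1 / ln t)) (powRE_gt1 (1 / ln t))// divfK// gt_eqF.
have [_ H _] := Kapprox t1; have [y Ky yv] := H _ KKv.
have dy : t `^ (- lambda) < expR 1 * kap ^+ 2 * dot (c t) y.
  rewrite -mulrA -ltr_pdivrMl// mulrC -rE; apply: (lt_le_trans Hi).
  have [+ _] := tcost_close i t1 Ky yv; move/le_trans; apply.
  by rewrite ler_pM2l// dot_term_le.
have dy0 : 0 < dot (c t) y.
  have := lt_trans (powR_gt1_gt0 (- lambda) t1) dy.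
  by rewrite pmulr_rgt0// mulr_gt0.
have dom z : K t z -> t `^ lambda * dot (c t) z <= 1 ->
    dot (c t) z <= B * dot (c t) (C t (t `^ lambda)).
  move=> Kz zc; rewrite mulr_sumr; apply: ler_sum => j _.
  by rewrite mulrCA; apply: ler_wpM2l; [exact: cge0|exact: Cdom].
have K0 : 0 < expR 1 * kap ^+ 2 by rewrite mulr_gt0.
have [small|big] := leP (t `^ lambda * dot (c t) y) 1.
  by apply: (le_trans (ltW dy)); rewrite -[leRHS]mulrA ler_pM2l// dom.
have q0 : 0 < t `^ lambda * dot (c t) y by rewrite mulr_gt0.
have := dom ((t `^ lambda * dot (c t) y)^-1 *: y); rewrite dotZ.
have -> : (t `^ lambda * dot (c t) y)^-1 * dot (c t) y = t `^ (- lambda).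
  by rewrite powRN; field; rewrite !gt_eqF.
have -> : t `^ lambda * t `^ (- lambda) = 1 by rewrite powRN mulfV// gt_eqF.
move=> /(_ _ (lexx _)) {}dom; rewrite -[leRHS]mulrA.
have {}dom : t `^ (- lambda) <= B * dot (c t) (C t (t `^ lambda)).
  by apply: dom; apply: Kscale => //; rewrite invr_ge0 ltW//= invf_le1// ltW.
by apply: (le_trans dom); rewrite ler_peMl ?mulr_ege1// (le_trans _ dom)// powR_ge0.
Qed.

(** The hypothesis says mu >= lambda - log_t P. Lowering the level raises an entry by at most as
    much, and raising the level does not raise it. *)
Lemma trop_coord_le_mul t P i lambda mu : 1 < t -> 1 <= P ->
  t `^ (- mu) <= P * t `^ (- lambda) ->
  t `^ trop_coord i mu <= P * t `^ trop_coord i lambda.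
Proof.
move=> t1 P1; have P0 : 0 < P by exact: lt_le_trans ltr01 P1.
rewrite -[P](powR_logK t1 P0) -!powR_add// !ler_powR_gt1// => H.
have D0 : 0 <= ln P / ln t by rewrite divr_ge0 ?ln_ge0// ltW// ln_gt0.
have [lm|/ltW ml] := leP lambda mu.
  by apply: le_trans (trop_coord_nincr i lm) _; rewrite lerDr.
have := trop_coord_lipschitz i ml; lra.
Qed.

(** * Neighborhoods of the central path and segments inside them *)

Variables (m1 m2 : R).
Hypotheses (m10 : 0 < m1) (m21 : 1 < m2).

Let nbhd t := mult_nbhd_on (K t) (C t) m1 m2
  [set eta | (epow t (- ereal_sup [set tdot cc x | x in KK]) <= eta%:E)%E].

(** Both z and [C t eta] have cost of order 1 / eta, by [Ccost] and [central_cost_ge]. So sigma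
    differs from log_t eta by at most log_t P, and [trop_coord_le_mul] transfers this to the
    entries. *)
Lemma nbhd_close : exists2 Q, 1 <= Q & forall t z, 1 < t -> nbhd t z ->
  exists2 sigma, dot (c t) z = t `^ (- sigma) & forall i,
    z i ord0 <= Q * t `^ trop_coord i sigma /\ t `^ trop_coord i sigma <= Q * z i ord0.
Proof.
have [L L1 HL] := central_path_close.
have L0 : 0 < L by exact: lt_le_trans ltr01 L1.
have m20 : 0 < m2 by exact: lt_trans ltr01 m21.
pose A := expR 1 * kap ^+ 2 * B.
have A0 : 0 < A by rewrite !mulr_gt0 ?expR_gt0 ?exprn_gt0.
pose P := 1 + m2 * G + A / m1.
have mG : 0 < m2 * G by rewrite mulr_gt0.
have Am : 0 < A / m1 by rewrite divr_gt0.
have P1 : 1 <= P by rewrite /P; move: mG Am; lra.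
have P0 : 0 < P by exact: lt_le_trans ltr01 P1.
exists (P * L * (m2 + m1^-1)).
  have m1V : 0 < m1^-1 by rewrite invr_gt0.
  apply: mulr_ege1; first exact: mulr_ege1.
  by move: m21 m1V; lra.
move=> t z t1 [eta [/= Heta eta0] [Kz Hz]].
pose lambda := ln eta / ln t; have etaE : t `^ lambda = eta by exact: powR_logK.
rewrite -etaE in Heta Hz eta0.
set x := C t (t `^ lambda) in Hz.
have Hsup : (- lambda%:E <= ereal_sup [set tdot cc x | x in KK])%E.
  by rewrite leeNl; exact: epow_le Heta.
have cl := central_cost_ge t1 Hsup; rewrite -/x -/A in cl.
have cu := Ccost t1 eta0; rewrite -/x in cu.
have zl : m1 * dot (c t) x <= dot (c t) z.
  rewrite -dotZ; apply: ler_sum => i _; apply: ler_wpM2l; first exact: cge0.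
  by rewrite mxE; have /andP[] := Hz i.
have zu : dot (c t) z <= m2 * dot (c t) x.
  rewrite -dotZ; apply: ler_sum => i _; apply: ler_wpM2l; first exact: cge0.
  by rewrite mxE; have /andP[] := Hz i.
have tl0 := powR_gt1_gt0 (- lambda) t1.
have dz0 : 0 < dot (c t) z.
  apply: lt_le_trans zl; rewrite mulr_gt0//.
  by have := lt_le_trans tl0 cl; rewrite pmulr_rgt0.
pose sigma := - (ln (dot (c t) z) / ln t).
have dzE : dot (c t) z = t `^ (- sigma) by rewrite /sigma opprK powR_logK.
have P_up : t `^ (- sigma) <= P * t `^ (- lambda).
  rewrite -dzE; apply: (le_trans zu).
  apply: (@le_trans _ _ (m2 * G * t `^ (- lambda))); last first.
    by rewrite ler_pM2r// /P; move: Am; lra.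
  by rewrite -mulrA ler_pM2l// powRN ler_pdivlMr// mulrC.
have P_dn : t `^ (- lambda) <= P * t `^ (- sigma).
  rewrite -dzE; apply: (le_trans cl).
  apply: (@le_trans _ _ (A / m1 * dot (c t) z)); last first.
    by rewrite ler_pM2r// /P; move: mG; lra.
  by rewrite -mulrA ler_pM2l// ler_pdivlMl.
exists sigma => // i.
have [H1 H2] := HL t lambda i t1; have /andP[z1 z2] := Hz i; rewrite -/x in H1 H2.
have r1 := trop_coord_le_mul i t1 P1 P_up.
have r2 := trop_coord_le_mul i t1 P1 P_dn.
have x0 := C_gt0 t1 eta0 i; rewrite -/x in x0.
have s0 := powR_gt1_gt0 (trop_coord i sigma) t1.
have z0 : 0 < z i ord0 by apply: lt_le_trans z1; rewrite mulr_gt0.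
split.
  apply: (le_trans z2); apply: (@le_trans _ _ (m2 * (L * (P * t `^ trop_coord i sigma)))).
    by rewrite ler_pM2l// (le_trans H1)// ler_pM2l.
  rewrite [leLHS](_ : _ = P * L * m2 * t `^ trop_coord i sigma); last by ring.
  by rewrite ler_pM2r// ler_pM2l ?mulr_gt0// lerDl invr_ge0 ltW.
apply: (le_trans r1); apply: (@le_trans _ _ (P * (L * (m1^-1 * z i ord0)))).
  by rewrite ler_pM2l// (le_trans H2)// ler_pM2l// ler_pdivlMl.
rewrite [leLHS](_ : _ = P * L * m1^-1 * z i ord0); last by ring.
by rewrite ler_pM2r// ler_pM2l ?mulr_gt0// lerDr ltW.
Qed.

(** The cost is affine, so each level lambda in [mu, nu] is reached at some w = (1 - s) y + s z.
    There 1 - s <= t^-(lambda - mu) yields the shifted term, and s <= 1 the other. Two uses of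
    [nbhd_close] give Q^2, and bounding a sum by twice the maximum gives the 2. *)
Lemma nbhd_segment_near_tsegm : exists2 N, 0 <= N & forall t, 1 < t ->
  forall y z, segment y z `<=` nbhd t -> forall mu nu,
  dot (c t) y = t `^ (- mu) -> dot (c t) z = t `^ (- nu) -> mu <= nu ->
  near_tsegm trop_coord mu nu (N / ln t).
Proof.
have [Q Q1 HQ] := nbhd_close; have Q0 : 0 < Q by exact: lt_le_trans ltr01 Q1.
have Q2 : 1 <= 2 * Q ^+ 2 by rewrite mulr_ege1// ?exprn_ege1// ler1n.
have Q20 : 0 < 2 * Q ^+ 2 by exact: lt_le_trans ltr01 Q2.
exists (ln (2 * Q ^+ 2)); first exact: ln_ge0.
move=> t t1 y z yz mu nu ymu znu munu.
have level w sigma : nbhd t w -> dot (c t) w = t `^ (- sigma) -> forall i,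
    w i ord0 <= Q * t `^ trop_coord i sigma /\ t `^ trop_coord i sigma <= Q * w i ord0.
  move=> Nw wE; have [s sE H] := HQ _ _ t1 Nw.
  suff -> : sigma = s by [].
  by apply/oppr_inj/(powR_gt1_inj t1); rewrite -wE.
have Ny : nbhd t y.
  by apply: yz; exists 0; rewrite ?subr0 ?scale1r ?scale0r ?addr0//= in_itv/= lexx ler01.
have Nz : nbhd t z.
  by apply: yz; exists 1; rewrite ?subrr ?scale1r ?scale0r ?add0r//= in_itv/= lexx ler01.
have e0 : 0 <= ln (2 * Q ^+ 2) / ln t by rewrite divr_ge0 ?ln_ge0// ltW// ln_gt0.
apply: near_tsegm_inside => //; [exact: trop_coord_nincr|exact: trop_coord_lipschitz|].
move=> i lambda /andP[ml ln_].
set Tm := t `^ (- mu) in ymu; set Tn := t `^ (- nu) in znu; pose Tl := t `^ (- lambda).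
have Tm0 : 0 < Tm by exact: powR_gt1_gt0.
have Tl0 : 0 < Tl by exact: powR_gt1_gt0.
have TmTl : Tl <= Tm by rewrite ler_powR_gt1// lerN2.
have TlTn : Tn <= Tl by rewrite ler_powR_gt1// lerN2.
have [s /andP[s0 s1] sE] : exists2 s, 0 <= s <= 1 & (1 - s) * Tm + s * Tn = Tl.
  have [TmTn|TnTm] := eqVneq Tm Tn.
    exists 0; rewrite ?lexx ?ler01// subr0 mul1r mul0r addr0.
    by apply/eqP; rewrite eq_le TmTl TmTn TlTn.
  have d0 : 0 < Tm - Tn.
    by rewrite subr_gt0 lt_neqAle eq_sym TnTm (le_trans TlTn).
  exists ((Tm - Tl) / (Tm - Tn)); last first.
    have mix (u v w : R) : u - v != 0 ->
      (1 - (u - w) / (u - v)) * u + (u - w) / (u - v) * v = w by move=> ?; field.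
    by apply: mix; rewrite gt_eqF.
  rewrite ler_pdivrMr// mul1r lerD2l lerN2 TlTn andbT.
  by apply: divr_ge0; [rewrite subr_ge0|exact: ltW].
pose w := (1 - s) *: y + s *: z.
have Nw : nbhd t w by apply: yz; exists s; rewrite //= in_itv/= s0.
have wE : dot (c t) w = Tl by rewrite /w dotD !dotZ ymu znu.
have [_ Hw] := level _ _ Nw wE i.
have [Hy _] := level _ _ Ny ymu i; have [Hz Hz'] := level _ _ Nz znu i.
have Tn0 : 0 < Tn by exact: powR_gt1_gt0.
have s1' : (1 - s) * Tm <= Tl by rewrite -sE lerDl mulr_ge0// ltW.
set a := trop_coord i mu - (lambda - mu); set b := trop_coord i nu.
have ya : (1 - s) * y i ord0 <= Q * t `^ a.
  have aE : t `^ a = t `^ trop_coord i mu * Tl / Tm.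
    rewrite /a /Tl /Tm !powRN invrK -powRN -!powR_add//; congr (_ `^ _); ring.
  apply: (@le_trans _ _ ((1 - s) * (Q * t `^ trop_coord i mu))).
    by rewrite ler_wpM2l// subr_ge0.
  rewrite aE mulrCA ler_pM2l// mulrC -mulrA ler_wpM2l ?powR_ge0//.
  by rewrite ler_pdivlMr.
have zb : s * z i ord0 <= Q * t `^ b.
  apply: le_trans Hz; rewrite ler_piMl//.
  by rewrite -(pmulr_rge0 _ Q0) (le_trans _ Hz')// powR_ge0.
rewrite -(ler_powR_gt1 _ _ t1) powR_add// powR_logK// mulrC.
apply: (le_trans Hw); rewrite /w !mxE.
have Ma : t `^ a <= t `^ Num.max a b by rewrite ler_powR_gt1// le_max lexx.
have Mb : t `^ b <= t `^ Num.max a b by rewrite ler_powR_gt1// le_max lexx orbT.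
rewrite (_ : 2 * Q ^+ 2 * _ = Q * (Q * t `^ Num.max a b + Q * t `^ Num.max a b)); last by ring.
rewrite ler_pM2l//; apply: lerD; first by apply: (le_trans ya); rewrite ler_pM2l.
by apply: (le_trans zb); rewrite ler_pM2l.
Qed.

End central_path_limit.

(** * Positivity of interior points and the bound on the number of segments *)

Lemma interior_gt0 (R : realType) (n : nat) (K : set 'cV[R]_n) x i :
  (forall x, K x -> forall i, 0 <= x i ord0) -> (K°) x -> 0 < x i ord0.
Proof.
move=> Kge0 /nbhs_norm_le[r r0 rK].
pose s := r / (`|basis_vec i : 'cV[R]_n| + 1).
have N0 : 0 < `|basis_vec i : 'cV[R]_n| + 1 by rewrite ltr_wpDl.
have s0 : 0 < s by rewrite divr_gt0.
have : K (x - s *: basis_vec i).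
  apply: rK; rewrite [x - _]addrC addrK normrN normrZ gtr0_norm//.
  by rewrite /s mulrAC ltr_pdivrMr// ltr_pM2l// ltrDl.
by move=> /Kge0/(_ i); rewrite !mxE !eqxx mulr1 subr_ge0; exact: lt_le_trans.
Qed.

Lemma segment_endpoints (R : realType) (n : nat) (x y : 'cV[R]_n) :
  segment x y x /\ segment x y y.
Proof.
split; [exists 0|exists 1]; rewrite /= ?in_itv/= ?lexx ?ler01//.
  by rewrite subr0 scale1r scale0r addr0.
by rewrite subrr scale0r scale1r add0r.
Qed.

Theorem theorem21 (R : realType) (n : nat)
  (K : R -> set 'cV[R]_n) (c : R -> 'cV[R]_n)
  (f : R -> 'cV[R]_n -> R) (vartheta : R)
  (C : R -> R -> 'cV[R]_n)
  (KK : set 'cV[\bar R]_n) (cc : 'cV[\bar R]_n)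
  (hK_poly : forall t, 1 < t -> polyhedron (K t))
  (hK_pos : forall t, 1 < t -> forall x, K t x -> forall i, 0 <= x i ord0)
  (hK_int : forall t, 1 < t -> (K t)° !=set0)
  (hK_0 : forall t, 1 < t -> K t 0)
  (hc_pos : forall t, 1 < t -> forall i, 0 <= c t i ord0)
  (hf : forall t, 1 < t -> self_concordant_barrier (K t)° (f t) vartheta)
  (hC : forall t eta, 1 < t -> 0 < eta ->
     unique_minimizer (K t)° (fun x => eta * dot (c t) x + f t x) (C t eta))
  (hKK : KK `<=` tvec) (hcc : tvec cc)
  (h_dist : exists M : R, forall t, 1 < t ->
     (maxe (hausdorff (logtv t @` K t) KK) (dinf (logtv t (c t)) cc)
        * (ln t)%:E <= M%:E)%E)
  (hKK_reg : regular_closed KK)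
  (hKK_poly : finite_union_of_polyhedra (finite_points KK))
  (hKK_bnd : forall lambda : R, bounded_from_above (tsublevel KK cc lambda))
  (h_tsegm : forall a b : R, a <= b ->
     exists p, tsegm_decomposition (tcentral_path KK cc) a b p)
  (m1 m2 : R) (hm : 0 < m1 < 1) (hm' : 1 < m2)
  (a b : R) :
  let lambda_star := (- ereal_sup [set tdot cc x | x in KK])%E in
  exists t0 : R, 1 < t0 /\
    forall t, t0 <= t ->
    forall (p : nat) (x : nat -> 'cV[R]_n),
      (0 < p)%N ->
      \bigcup_(i in [set i | (i < p)%N]) segment (x i) (x i.+1) `<=`
        mult_nbhd_on (K t) (C t) m1 m2
          [set eta | (epow t lambda_star <= eta%:E)%E] ->
      dot (c t) (x p) <= dot (c t) (x 0%N) ->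
      (- logt t (dot (c t) (x 0%N)))%E = a%:E ->
      (- logt t (dot (c t) (x p)))%E = b%:E ->
      (tcomplexity (tcentral_path KK cc) a b <= p%:R%:E)%E.
Proof.
move=> lambda_star; have [m10 _] := andP hm.
have [M HM] := h_dist.
have [kap kap1 Kapprox] := hausdorff_mult_close hK_pos hc_pos hKK hcc HM.
pose Th := Num.max vartheta 1.
have Th1 : 1 <= Th by rewrite le_max lexx orbT.
have hfT t : 1 < t -> forall x, ((K t)°) x ->
    local_norm (f t) x (invmx (hess (f t) x) *m grad (f t) x) ^+ 2 <= Th.
  by move=> t1 x Kx; have [_ H] := hf t t1; apply: le_trans (H x Kx) _; rewrite le_max lexx.
have CKint t eta : 1 < t -> 0 < eta -> ((K t)°) (C t eta).
  by move=> t1 e0; have [] := hC _ _ t1 e0.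
have CK t eta : 1 < t -> 0 < eta -> K t (C t eta).
  by move=> t1 e0; apply: interior_subset; exact: CKint.
have Kscale t : 1 < t -> forall x s, K t x -> 0 <= s <= 1 -> K t (s *: x).
  move=> t1 x s Kx s01.
  have := polyhedron_convex (hK_poly _ t1) (hK_0 _ t1) Kx s01.
  by rewrite subr0 add0r.
have C_gt0 t eta : 1 < t -> 0 < eta -> forall i, 0 < C t eta i ord0.
  by move=> t1 e0 i; apply: (interior_gt0 i (hK_pos _ t1)); exact: CKint.
have Ccost t eta : 1 < t -> 0 < eta -> eta * dot (c t) (C t eta) <= 2 * Th.
  move=> t1 e0; have [fsc _] := hf t t1.
  exact: (minimizer_cost_le (hK_poly _ t1) (hK_0 _ t1) fsc Th1 (hfT _ t1) (hC _ _ t1 e0)).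
have Cdom t eta : 1 < t -> 0 < eta -> forall y, K t y -> eta * dot (c t) y <= 1 ->
    forall i, y i ord0 <= (64 * Th + 33) * C t eta i ord0.
  move=> t1 e0 y Ky cy i; have [fsc _] := hf t t1.
  exact: (minimizer_dominate (hK_poly _ t1) (hK_pos _ t1) fsc Th1 (hfT _ t1)
    (hc_pos _ t1) e0 (hC _ _ t1 e0) i Ky cy).
have G1 : 1 <= 2 * Th by move: Th1; lra.
have B1 : 1 <= 64 * Th + 33 by move: Th1; lra.
have PE l i := tcentral_pathE hKK hcc hK_pos Kscale hc_pos kap1 G1 Kapprox CK C_gt0
  Ccost hKK_bnd i l.
have [Q _ HQ] := nbhd_close hKK hcc hK_pos Kscale hc_pos kap1 G1 B1 Kapprox CK C_gt0
  Ccost Cdom hKK_bnd m10 hm'.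
have [N N0 HN] := nbhd_segment_near_tsegm hKK hcc hK_pos Kscale hc_pos kap1 G1 B1
  Kapprox CK C_gt0 Ccost Cdom hKK_bnd m10 hm'.
have rho_ni := trop_coord_nincr hKK hcc hK_pos Kscale hc_pos kap1 G1 Kapprox CK C_gt0
  Ccost hKK_bnd.
have rho_lip := trop_coord_lipschitz hKK hcc hK_pos Kscale hc_pos kap1 G1 Kapprox CK C_gt0
  Ccost hKK_bnd.
have levelE (t d r : R) : 1 < t -> 0 <= d -> (- logt t d)%E = r%:E -> d = t `^ (- r).
  move=> t1 d0 /(congr1 oppe); rewrite oppeK => /(logt_eq t1 d0) ->//.
have vertex t p (x : nat -> 'cV[R]_n) : (0 < p)%N ->
    \bigcup_(i in [set i | (i < p)%N]) segment (x i) (x i.+1) `<=`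
      mult_nbhd_on (K t) (C t) m1 m2 [set eta | (epow t lambda_star <= eta%:E)%E] ->
    forall j, (j <= p)%N ->
      mult_nbhd_on (K t) (C t) m1 m2 [set eta | (epow t lambda_star <= eta%:E)%E] (x j).
  move=> p0 xN j; rewrite leq_eqVlt => /predU1P[->|jp]; apply: xN.
    exists p.-1; rewrite /= prednK//; exact: (segment_endpoints _ _).2.
  by exists j => //; exact: (segment_endpoints _ _).1.
have dge0 t p (x : nat -> 'cV[R]_n) : 1 < t -> (0 < p)%N ->
    \bigcup_(i in [set i | (i < p)%N]) segment (x i) (x i.+1) `<=`
      mult_nbhd_on (K t) (C t) m1 m2 [set eta | (epow t lambda_star <= eta%:E)%E] ->
    forall j, (j <= p)%N -> 0 <= dot (c t) (x j).
  move=> t1 p0 xN j jp; have [eta _ [Kx _]] := vertex _ _ _ p0 xN j jp.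
  by apply: dot_ge0; [exact: hc_pos|exact: hK_pos t1 _ Kx].
(* If b < a, the ordering of the costs is contradicted, so any threshold works. *)
have [ab|ba] := leP a b; last first.
  exists 2; split=> [|t t2 p x p0 xN dle ha hb]; first by rewrite ltr1n.
  have t1 : 1 < t by rewrite (lt_le_trans _ t2)// ltr1n.
  move: dle; rewrite (levelE _ _ _ t1 (dge0 _ _ _ t1 p0 xN _ (leqnn p)) hb).
  rewrite (levelE _ _ _ t1 (dge0 _ _ _ t1 p0 xN _ (leq0n p)) ha) ler_powR_gt1// lerN2.
  by rewrite leNgt ba.
(* The complexity is at most q0, so sequences with more than q0 segments satisfy the bound; the
   others share one error threshold e. *)
have [q0 Hq0] := h_tsegm _ _ ab.
have [e e0 He] := tsegm_decomposition_stable rho_ni rho_lip PE a b q0.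
have Ne : 0 < N / e + 1 by rewrite ltr_wpDl// divr_ge0// ltW.
(* Makes N / ln t <= e; the added 1 keeps the threshold above 1 when N = 0. *)
exists (expR (N / e + 1)); split=> [|t tge p x p0 xN dle ha hb].
  by rewrite expR_gt1.
have t1 : 1 < t by rewrite (lt_le_trans _ tge)// expR_gt1.
have lt0 := ln_gt0 t1.
have NlnE : N / ln t <= e.
  rewrite ler_pdivrMr// mulrC -ler_pdivrMr//; apply: (@le_trans _ _ (N / e + 1)).
    by rewrite lerDl.
  by rewrite -[leLHS]expRK ler_ln// posrE ?expR_gt0// (lt_trans ltr01).
have [pq|qp] := leqP p q0; last first.
  apply: (@le_trans _ _ q0%:R%:E); last by rewrite lee_fin ler_nat ltnW.
  by apply: ereal_inf_lbound; exists q0.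
apply: ereal_inf_lbound; exists p => //; apply: He => //.
(* Levels of the vertices, whose costs are positive by [nbhd_close]. *)
pose l j := - (ln (dot (c t) (x j)) / ln t).
have lE j : (j <= p)%N -> dot (c t) (x j) = t `^ (- l j).
  move=> jp; rewrite /l opprK powR_logK//.
  have [s -> _] := HQ _ _ t1 (vertex _ _ _ p0 xN j jp).
  exact: powR_gt1_gt0.
(* Levels may go back and forth; only ascending segments have to be near tropical segments. *)
apply: (near_tsegm_chain_monotone rho_ni rho_lip (l := l) (ltW e0) ab).
- apply/oppr_inj/(powR_gt1_inj t1); rewrite -lE//.
  exact: levelE t1 (dge0 _ _ _ t1 p0 xN _ (leq0n p)) ha.
- apply/oppr_inj/(powR_gt1_inj t1); rewrite -lE//.
  exact: levelE t1 (dge0 _ _ _ t1 p0 xN _ (leqnn p)) hb.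
move=> j jp lj i r.
have xj : segment (x j) (x j.+1) `<=`
    mult_nbhd_on (K t) (C t) m1 m2 [set eta | (epow t lambda_star <= eta%:E)%E].
  by move=> z zj; apply: xN; exists j.
apply: (le_trans (HN _ t1 _ _ xj _ _ (lE _ (ltnW jp)) (lE _ jp) lj i r)).
by rewrite lerD2l.
Qed.
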